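(* If $H$ is a vertex of $\mathcal H_\star(N-1)$ and is decomposable at $N'\in\{1,\dots,N-1\}$, then it has an optimal guarantee on $y_{N'-1}$: for every nonexpansive $T:\mathcal X\to\mathcal X$ with a fixed point $y_\star$ and every $y_0\in\mathcal X$, the iterates of the algorithm defined by $H$ satisfy $$\|y_{N'-1}-Ty_{N'-1}\|^2\le\frac{4\|y_0-y_\star\|^2}{(N')^2}.$$
   Context: Algorithms. Let $N\ge 1$ be an integer. An H-matrix of size $N-1$ is a real lower triangular matrix $H=(h_{k,j})_{1\le j\le k\le N-1}$. Given a real Hilbert space $\mathcal X$, an operator $T:\mathcal X\to\mathcal X$ and $y_0\in\mathcal X$, the algorithm defined by $H$ generates $y_{k+1}=y_k-\sum_{j=0}^{k}h_{k+1,j+1}(y_j-Ty_j)$ for $k=0,\dots,N-2$. $T$ is nonexpansive if $\|Tx-Ty\|\le\|x-y\|$ for all $x,y\in\mathcal X$; $y_\star$ is a fixed point if $Ty_\star=y_\star$. $\mathcal H_\star(N-1)$ is the set of H-matrices of size $N-1$ such that $\|y_{N-1}-Ty_{N-1}\|^2\le 4\|y_0-y_\star\|^2/N^2$ for every real Hilbert space $\mathcal X$, every nonexpansive $T:\mathcal X\to\mathcal X$ with a fixed point $y_\star$ and every $y_0\in\mathcal X$. H-certificates. For $m,j\in\{1,\dots,N-1\}$ let $Q(m,j;H)=\sum\prod_{r=1}^m h_{i(r),j(r)}$, the sum over all integers $j=j(1)\le i(1)<j(2)\le i(2)<\cdots<j(m)\le i(m)\le N-1$ (an empty sum is $0$).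 The H-certificates of $H$ are $\lambda^\star_{N,j}(H)=N\sum_{m=1}^{N-1}(-1)^{m-1}Q(m,j;H)$ for $1\le j\le N-1$, and $\lambda^\star_{k,j}(H)=N\sum_{\ell=1}^{N-1}\sum_{m=1}^{N-1}(-1)^{\ell+m-1}\binom{\ell+m}{m}Q(\ell,j;H)Q(m,k;H)$ for $1\le j<k\le N-1$. Known fact (Yoon–Ryu–Grimmer): $H\in\mathcal H_\star(N-1)$ if and only if $\sum_{j=1}^{N-1}Q(k,j;H)=\frac1N\binom{N}{k+1}$ for $k=1,\dots,N-1$ and $\lambda^\star_{k,j}(H)\ge 0$ for all $1\le j<k\le N$. Vertices. A vertex of $\mathcal H_\star(N-1)$ is an $H\in\mathcal H_\star(N-1)$ such that for each $j=1,\dots,N-1$ there is exactly one index $k(j)\in\{j+1,\dots,N\}$ with $\lambda^\star_{k(j),j}(H)>0$. Decomposability. $H\in\mathcal H_\star(N-1)$ is decomposable at $N'\in\{1,\dots,N-1\}$ if (i) $\lambda^\star_{N,N'}(H)>0$ and $\lambda^\star_{k,N'}(H)=0$ for $k=N'+1,\dots,N-1$, and (ii) $\lambda^\star_{k,j}(H)=0$ for all $j=1,\dots,N'-1$ and $k=N'+1,\dots,N$. *)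

(* Defs.v *)
(* MathComp / MathComp-Analysis *)
From HB Require Import structures.
From mathcomp Require Import all_boot all_order all_algebra.
From mathcomp Require Import all_classical all_reals all_analysis.
Set Implicit Arguments.
Unset Strict Implicit.
Unset Printing Implicit Defensive.
Import Order.TTheory GRing.Theory Num.Theory.
Import numFieldNormedType.Exports.
Local Open Scope classical_set_scope.
Local Open Scope ring_scope.

(* A real Hilbert space: a complete normed space whose norm comes from a
   symmetric positive definite bilinear form. *)
HB.mixin Record CompleteNormedModule_isHilbert (R : realType) X
    & CompleteNormedModule R X := {
  inner : {dot X for idfun} ;
  inner_norm : forall x : X, inner x x = `|x| ^+ 2
}.

#[short(type="hilbertType")]
HB.structure Definition Hilbert (R : realType) :=
  {X of CompleteNormedModule R X & CompleteNormedModule_isHilbert R X}.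

Definition nonexpansive (R : realType) (X : hilbertType R) (T : X -> X) : Prop :=
  forall x y : X, `|T x - T y| <= `|x - y|.

(* The matrix is indexed from 0: its entry (a, b) is h_{a+1,b+1}.  Only the
   values y 0, ..., y N.-1 are constrained. *)
Definition iterates (R : realType) (X : hilbertType R) (N : nat)
    (H : 'M[R]_(N.-1)) (T : X -> X) (y : nat -> X) : Prop :=
  forall k : 'I_(N.-1),
    y k.+1 = y k - \sum_(j < N.-1 | (j <= k)%N) H k j *: (y j - T (y j)).
Arguments iterates {R X} N H T y.

(* is_trig_mx is lower triangularity. *)
Definition Hstar (R : realType) (N : nat) : set 'M[R]_(N.-1) :=
  [set H | is_trig_mx H /\
    forall (X : hilbertType R) (T : X -> X) (ystar : X) (y : nat -> X),
      nonexpansive T -> T ystar = ystar -> iterates N H T y ->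
      `|y N.-1 - T (y N.-1)| ^+ 2 <= 4 * `|y 0%N - ystar| ^+ 2 / N%:R ^+ 2].
Arguments Hstar R N : clear implicits.

(* p.1 = (i(1), ..., i(m)) and p.2 = (j(1), ..., j(m)), all shifted down by 1,
   satisfy j = j(1) <= i(1) < j(2) <= i(2) < ... < j(m) <= i(m); here j itself
   is not shifted. *)
Definition Qindex (n m j : nat)
    (p : {ffun 'I_m -> 'I_n} * {ffun 'I_m -> 'I_n}) : bool :=
  [&& [forall r : 'I_m, (r == 0 :> nat) ==> ((p.2 r).+1 == j)],
      [forall r : 'I_m, p.2 r <= p.1 r]%N &
      [forall r : 'I_m, forall s : 'I_m,
        (s == r.+1 :> nat) ==> (p.1 r < p.2 s)%N]].

Definition Q (R : realType) (n : nat) (H : 'M[R]_n) (m j : nat) : R :=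
  \sum_(p : {ffun 'I_m -> 'I_n} * {ffun 'I_m -> 'I_n} | Qindex j p)
     \prod_(r < m) H (p.1 r) (p.2 r).

(* certificate N H k j is lambda^*_{k,j}(H), with indices starting at 1; it is
   meaningful for 1 <= j < k <= N. *)
Definition certificate (R : realType) (N : nat) (H : 'M[R]_(N.-1))
    (k j : nat) : R :=
  if k == N then
    N%:R * \sum_(1 <= m < N) (-1) ^+ (m - 1) * Q H m j
  else
    N%:R * \sum_(1 <= l < N) \sum_(1 <= m < N)
      (-1) ^+ (l + m - 1) * ('C(l + m, m))%:R * Q H l j * Q H m k.
Arguments certificate {R} N H k j.

Definition vertex (R : realType) (N : nat) (H : 'M[R]_(N.-1)) : Prop :=
  Hstar R N H /\
  forall j : nat, (1 <= j < N)%N ->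
    exists! k : nat, (j < k <= N)%N /\ 0 < certificate N H k j.
Arguments vertex {R} N H.

Definition decomposable (R : realType) (N : nat) (H : 'M[R]_(N.-1))
    (N' : nat) : Prop :=
  [/\ Hstar R N H,
      (1 <= N' < N)%N,
      0 < certificate N H N N'
        /\ forall k : nat, (N' < k < N)%N -> certificate N H k N' = 0 &
      forall j k : nat, (1 <= j < N')%N -> (N' < k <= N)%N ->
        certificate N H k j = 0].
Arguments decomposable {R} N H N'.

(* Main.v *)
(* Index steps from 0 and write r_k = y_k - T y_k, so that y_k = y_0 - (M r)_k with M the
   strictly lower triangular matrix of cumulated steps. Then Q(m, j) is an entry of the
   last row of M^m, and the certificates are the off-diagonal entries of -N times the
   solution L of the Lyapunov equation L + L M + M^T L = e e^T, e the last basis vector.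

   Running H on the isometry U with U^N = -1 gives y_k = p_k(U) y_0; let S be the lower
   triangular matrix of coefficients of the polynomials p_k. Optimality of H on U forces
   the last row of S to be constant, and then L = N^-2 (S S^T)^-1. Folding the space
   across a suitable hyperplane before applying U shows that the off-diagonal entries of
   (S S^T)^-1 are nonpositive when H is in Hstar. Conversely, a constant last row of S and
   this sign condition yield the guarantee by summing the nonexpansiveness inequalities.

   All these objects are compatible with truncation of H. If H is decomposable at N', the
   lower left block of S^-1 is supported in its last column, so the lower left block of S
   has all rows proportional to the last row of the leading block S', which is therefore
   constant, and the leading block of (S S^T)^-1 differs from (S' S'^T)^-1 only in its
   last diagonal entry. *)
Require Import Defs.
From HB Require Import structures.
From mathcomp Require Import all_boot all_order all_algebra.
From mathcomp Require Import all_classical all_reals all_analysis.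
From mathcomp Require Import ring lra zify.
Set Implicit Arguments.
Unset Strict Implicit.
Unset Printing Implicit Defensive.
Import Order.TTheory GRing.Theory Num.Theory.
Import numFieldNormedType.Exports.
Local Open Scope classical_set_scope.
Local Open Scope ring_scope.

(** * Euclidean spaces as Hilbert spaces *)

Section EuclideanSpace.
Variables (R : realType) (n : nat).

(** A separate name, because row vectors already carry the sup norm as matrices. *)
Definition euclidean := 'rV[R]_n.
HB.instance Definition _ := GRing.Lmodule.on euclidean.
Implicit Types u v w : euclidean.

Definition dotv u v : R := \sum_i u 0 i * v 0 i.

Lemma dotvC u v : dotv u v = dotv v u.
Proof. by apply: eq_bigr => i _; rewrite mulrC. Qed.

Lemma dotv_is_linear u : scalar (dotv u).
Proof.
move=> a v w; rewrite /dotv mulr_sumr -big_split /=.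
by apply: eq_bigr => i _; rewrite !mxE mulrDr mulrCA.
Qed.

Lemma dotvDr u v w : dotv u (v + w) = dotv u v + dotv u w.
Proof. by rewrite -[v]scale1r dotv_is_linear mul1r scale1r. Qed.

Lemma dotvBr u v w : dotv u (v - w) = dotv u v - dotv u w.
Proof. by rewrite addrC -scaleN1r dotv_is_linear mulN1r addrC. Qed.

Lemma dotvBl u v w : dotv (v - w) u = dotv v u - dotv w u.
Proof. by rewrite dotvC dotvBr !(dotvC u). Qed.

Lemma dotvDl u v w : dotv (v + w) u = dotv v u + dotv w u.
Proof. by rewrite dotvC dotvDr !(dotvC u). Qed.

Lemma dotvZr a u v : dotv u (a *: v) = a * dotv u v.
Proof. by rewrite mulr_sumr; apply: eq_bigr => i _; rewrite mxE mulrCA. Qed.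

Lemma dotvZl a u v : dotv (a *: u) v = a * dotv u v.
Proof. by rewrite dotvC dotvZr dotvC. Qed.

Lemma dotv_ge0 u : 0 <= dotv u u.
Proof. by apply: sumr_ge0 => i _; rewrite -expr2 sqr_ge0. Qed.

Lemma dotv_eq0 u : (dotv u u == 0) = (u == 0).
Proof.
apply/eqP/eqP => [/psumr_eq0P u0|->]; last first.
  by rewrite /dotv big1 // => i _; rewrite mxE mul0r.
apply/rowP => i; rewrite mxE; apply/eqP; rewrite -sqrf_eq0 expr2.
by apply/eqP/u0 => // j _; rewrite -expr2 sqr_ge0.
Qed.

Lemma dotv_CauchySchwarz u v : dotv u v ^+ 2 <= dotv u u * dotv v v.
Proof.
have [->|v0] := eqVneq v 0.
  have -> : dotv u 0 = 0 by rewrite -[0 in LHS](subrr 0) dotvBr subrr.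
  by rewrite expr0n /= mulr_ge0 ?dotv_ge0.
have v1 : 0 < dotv v v by rewrite lt_neqAle eq_sym dotv_eq0 v0 dotv_ge0.
have := dotv_ge0 (dotv v v *: u - dotv u v *: v).
rewrite dotvBr !dotvZr !dotvBl !dotvZl (dotvC v u) => h.
have : 0 <= dotv v v * (dotv u u * dotv v v - dotv u v ^+ 2) by lra.
by rewrite pmulr_rge0 // subr_ge0.
Qed.

Definition normv u : R := Num.sqrt (dotv u u).

Lemma normv_sqr u : normv u ^+ 2 = dotv u u.
Proof. by rewrite sqr_sqrtr ?dotv_ge0. Qed.

Lemma normvD u v : normv (u + v) <= normv u + normv v.
Proof.
rewrite -(@ler_pXn2r _ 2) ?nnegrE ?addr_ge0 ?sqrtr_ge0 //.
rewrite sqrrD !normv_sqr dotvDr !dotvDl (dotvC v u).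
suff : dotv u v <= normv u * normv v by lra.
rewrite -sqrtrM ?dotv_ge0 // (le_trans (ler_norm _)) // -sqrtr_sqr ler_sqrt.
  exact: dotv_CauchySchwarz.
by rewrite mulr_ge0 ?dotv_ge0.
Qed.

Lemma normvZ a u : normv (a *: u) = `|a| * normv u.
Proof.
rewrite /normv dotvZr dotvZl mulrA -expr2.
by rewrite sqrtrM ?sqr_ge0 // sqrtr_sqr.
Qed.

Lemma normv_eq0 u : normv u = 0 -> u = 0.
Proof.
by move=> u0; apply/eqP; rewrite -dotv_eq0 -normv_sqr u0 expr0n.
Qed.

HB.instance Definition _ :=
  Lmodule_isNormed.Build R euclidean normvD normvZ normv_eq0.

Lemma euclidean_normE u : `|u| = Num.sqrt (dotv u u).
Proof. by []. Qed.

Lemma ler_coord_norm u i : `|u 0 i| <= `|u|.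
Proof.
rewrite euclidean_normE -sqrtr_sqr ler_sqrt ?dotv_ge0 //.
by rewrite /dotv (bigD1 i) //= -expr2 lerDl sumr_ge0 // => j _; rewrite -expr2 sqr_ge0.
Qed.

Lemma euclidean_norm_le u : `|u| <= \sum_i `|u 0 i|.
Proof.
rewrite -[leRHS]ger0_norm ?sumr_ge0 // -sqrtr_sqr ler_sqrt ?sqr_ge0 //.
rewrite expr2 mulr_suml; apply: ler_sum => i _.
rewrite -expr2 -real_normK ?num_real // expr2 ler_wpM2l //.
by rewrite (bigD1 i) //= lerDl sumr_ge0.
Qed.

Lemma euclidean_complete (F : set_system euclidean) :
  ProperFilter F -> cauchy F -> cvg F.
Proof.
move=> FF /cauchyP Fc.
have cvgi i : exists l : R, (fun u : euclidean => u 0 i) @ F --> l.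
  apply/cvg_ex; apply: cauchy_cvg; apply: cauchy_exP => e e0.
  have [x Fx] := Fc e e0; exists (x 0 i).
  apply: (@filterS _ F _ _ _ _ Fx) => y.
  rewrite -!ball_normE /=; apply: le_lt_trans.
  by apply: le_trans (ler_coord_norm _ i); rewrite !mxE.
have [l Hl] := choice cvgi.
apply/cvg_ex; exists (\row_i l i : euclidean).
apply/cvgrPdist_lt => e e0.
(* Dividing by [n.+1] keeps the sum of the [n] coordinate errors strictly below [e], also when
   [n = 0]. *)
have d0 : 0 < e / n.+1%:R by rewrite divr_gt0.
have H : F [set u : euclidean | forall i, `|l i - u 0 i| < e / n.+1%:R].
  apply: filter_forall => i; move/cvgrPdist_lt: (Hl i) => /(_ _ d0); exact.
apply: (@filterS _ F _ _ _ _ H) => u Hu.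
apply: le_lt_trans (euclidean_norm_le _) _.
apply: (@le_lt_trans _ _ (\sum_(i < n) e / n.+1%:R)).
  by apply: ler_sum => i _; rewrite !mxE ltW.
rewrite sumr_const card_ord -mulrnAr -[ltRHS]mulr1 ltr_pM2l // -mulr_natl.
by rewrite ltr_pdivrMr // mul1r ltr_nat.
Qed.

HB.instance Definition _ := Uniform_isComplete.Build euclidean euclidean_complete.

Lemma dotv_is_bilinear : bilinear_for *%R (idfun \; *%R) dotv.
Proof. by split=> u; [move=> a v w; rewrite ![dotv _ u]dotvC|]; exact: dotv_is_linear. Qed.

HB.instance Definition _ := bilinear_isBilinear.Build R euclidean euclidean R
  (GRing.Scale.Law.clone _ _ ( *%R ) _)
  (GRing.Scale.Law.clone _ _ (idfun \; *%R) _) dotv dotv_is_bilinear.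

Lemma dotv_hermitian u v : dotv u v = (-1) ^+ false * idfun (dotv v u).
Proof. by rewrite expr0 mul1r dotvC. Qed.

HB.instance Definition _ := isHermitianSesquilinear.Build R euclidean false idfun
  dotv dotv_hermitian.

Lemma dotv_gt0 u : u != 0 -> 0 < dotv u u.
Proof. by move=> u0; rewrite lt_neqAle eq_sym dotv_eq0 u0 dotv_ge0. Qed.

HB.instance Definition _ := isDotProduct.Build R euclidean dotv dotv_gt0.

Lemma dotv_norm u : (dotv : {dot euclidean for idfun}) u u = `|u| ^+ 2.
Proof. by rewrite /= -normv_sqr. Qed.

HB.instance Definition _ := CompleteNormedModule_isHilbert.Build R euclidean
  dotv_norm.

End EuclideanSpace.

(** * Certificates imply the guarantee *)

Section Sufficiency.
Variables (R : realType) (X : hilbertType R).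
Implicit Types u v w : X.

Local Notation "''[' u , v ]" := (inner u v).

Lemma innerC u v : '[u, v] = '[v, u].
Proof. by rewrite (hermC inner) expr0 mul1r. Qed.

Lemma innerBr u v w : '[u, v - w] = '[u, v] - '[u, w].
Proof. exact: raddfB. Qed.

Lemma inner0r u : '[u, 0] = 0.
Proof. by rewrite -[0 in LHS](subrr u) innerBr subrr. Qed.

Lemma innerDr u v w : '[u, v + w] = '[u, v] + '[u, w].
Proof. by rewrite -[w in LHS]opprK -(sub0r w) !innerBr inner0r sub0r opprK. Qed.

Lemma innerBl u v w : '[v - w, u] = '[v, u] - '[w, u].
Proof. by rewrite innerC innerBr !(innerC u). Qed.

Lemma innerZr a u v : '[u, a *: v] = a * '[u, v].
Proof. exact: linearr_subproof. Qed.

Lemma innerZl a u v : '[a *: u, v] = a * '[u, v].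
Proof. by rewrite innerC innerZr innerC. Qed.

Lemma inner_sumZ (I : finType) u (a : I -> R) (f : I -> X) :
  '[u, \sum_i a i *: f i] = \sum_i a i * '[u, f i].
Proof.
rewrite (big_morph _ (innerDr u) (inner0r u)).
by apply: eq_bigr => i _; rewrite innerZr.
Qed.

Lemma inner_ge0 u : 0 <= '[u, u].
Proof. by rewrite inner_norm sqr_ge0. Qed.

(** With [d] the difference of the residuals and [w = u - v], [T u - T v = w - d]; expand
    [|w - d|^2 <= |w|^2]. *)
Lemma inner_firmly (T : X -> X) u v : nonexpansive T ->
  '[(u - T u) - (v - T v), (u - T u) - (v - T v)] / 2
    <= '[(u - T u) - (v - T v), u - v].
Proof.
move=> /(_ u v) Tuv.
have : `|T u - T v| ^+ 2 <= `|u - v| ^+ 2 by rewrite ler_pXn2r ?nnegrE.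
rewrite -!inner_norm.
have -> : T u - T v = (u - v) - ((u - T u) - (v - T v)).
  by rewrite !opprB addrA subrKA addrC subrKA.
move: (_ - _ - _) (u - v) => d w; rewrite innerBr !innerBl (innerC w d); lra.
Qed.

Variables (n : nat) (M P : 'M[R]_n.+1).
Hypothesis P_sym : P^T = P.
Hypothesis P_rowsum : forall k, \sum_j P k j = n.+1%:R * (k == ord_max)%:R.
Hypothesis P_lyapunov :
  P + P *m M + M^T *m P = n.+1%:R ^+ 2 *: delta_mx ord_max ord_max.
Hypothesis P_offdiag : forall k j : 'I_n.+1, (j < k)%N -> P k j <= 0.

Lemma certificate_sufficient (T : X -> X) (ystar : X) (y : nat -> X) :
  nonexpansive T -> T ystar = ystar ->
  (forall k : 'I_n.+1, y k = y 0%N - \sum_j M k j *: (y j - T (y j))) ->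
  `|y n - T (y n)| ^+ 2 <= 4 * `|y 0%N - ystar| ^+ 2 / n.+1%:R ^+ 2.
Proof.
move=> Tne Tfix yE.
have [r rE] : exists r : 'I_n.+1 -> X, forall k, r k = y k - T (y k).
  by exists (fun k => y k - T (y k)).
have {}yE (k : 'I_n.+1) : y k = y 0%N - \sum_j M k j *: r j.
  by rewrite yE; congr (_ - _); apply: eq_bigr => j _; rewrite rE.
pose z := y 0%N - ystar.
(* By [inner_firmly], [b k k] is the slack for the pair [y k], [ystar], and
   [b k k + b j j - b k j - b j k] the slack for [y k], [y j]. *)
pose b (k j : 'I_n.+1) : R := '[r k, y j - ystar] - '[r k, r j] / 2.
have PC k j : P k j = P j k by rewrite -[in LHS]P_sym mxE.
have b_ge0 k : 0 <= b k k.
  have := inner_firmly (y k) ystar Tne; rewrite Tfix subrr subr0 -rE.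
  by rewrite /b subr_ge0.
have bI k j : 0 <= b k k + b j j - b k j - b j k.
  have := inner_firmly (y k) (y j) Tne; rewrite -!rE /b.
  have -> : y k - y j = (y k - ystar) - (y j - ystar) by rewrite opprB addrA subrK.
  move: (y k - ystar) (y j - ystar) => u v.
  rewrite !innerBr !innerBl (innerC (r j) (r k)); lra.
(* After substitution of [yE], the row sums of [P] keep only the last residual against [z]. By
   symmetry [P M] and [M^T P] contribute equally, so the quadratic part is half of what the Lyapunov
   equation evaluates. *)
have b_cert : \sum_k \sum_j P k j * b k j =
    n.+1%:R * '[r ord_max, z] - n.+1%:R ^+ 2 / 2 * '[r ord_max, r ord_max].
  have -> : \sum_k \sum_j P k j * b k j = \sum_k (\sum_j P k j) * '[r k, z]
      - \sum_k \sum_i (P *m M) k i * '[r k, r i]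
      - \sum_k \sum_i P k i * '[r k, r i] / 2.
    rewrite -!sumrB; apply: eq_bigr => k _.
    rewrite mulr_suml [X in _ - X - _](_ : _ =
       \sum_j P k j * \sum_i M j i * '[r k, r i]); last first.
      under eq_bigr do rewrite mxE mulr_suml.
      rewrite exchange_big /=; apply: eq_bigr => j _.
      by rewrite mulr_sumr; apply: eq_bigr => i _; rewrite mulrA.
    rewrite -!sumrB; apply: eq_bigr => j _; rewrite /b yE addrAC innerBr -/z.
    rewrite inner_sumZ; ring.
  have -> : \sum_k (\sum_j P k j) * '[r k, z] = n.+1%:R * '[r ord_max, z].
    rewrite (bigD1 ord_max) //= P_rowsum eqxx mulr1 big1 ?addr0 // => k.
    by rewrite P_rowsum => /negPf ->; rewrite mulr0 mul0r.
  have PM_sym : \sum_k \sum_i (P *m M) k i * '[r k, r i]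
      = \sum_k \sum_i (M^T *m P) k i * '[r k, r i].
    rewrite exchange_big /=; apply: eq_bigr => k _; apply: eq_bigr => i _.
    rewrite innerC -[P *m M]trmxK mxE trmx_mul P_sym; congr (_ * _).
  have : \sum_k \sum_i (P + P *m M + M^T *m P) k i * '[r k, r i] =
      n.+1%:R ^+ 2 * '[r ord_max, r ord_max].
    rewrite P_lyapunov (bigD1 ord_max) //= (bigD1 ord_max) //= !mxE !eqxx mulr1.
    rewrite !big1 ?addr0 // => k /negPf k0; last by rewrite !mxE k0 andbF mulr0 mul0r.
    by apply: big1 => i _; rewrite !mxE k0 mulr0 mul0r.
  have -> : \sum_k \sum_i (P + P *m M + M^T *m P) k i * '[r k, r i] =
      \sum_k \sum_i P k i * '[r k, r i]
      + \sum_k \sum_i (P *m M) k i * '[r k, r i]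
      + \sum_k \sum_i (M^T *m P) k i * '[r k, r i].
    rewrite -!big_split; apply: eq_bigr => k _; rewrite -!big_split.
    by apply: eq_bigr => i _; rewrite mxE [X in X + _]mxE !mulrDl.
  rewrite -PM_sym.
  have -> : \sum_k \sum_i P k i * '[r k, r i] / 2 =
     (\sum_k \sum_i P k i * '[r k, r i]) / 2.
    by rewrite mulr_suml; apply: eq_bigr => k _; rewrite mulr_suml.
  lra.
(* Polarization rewrites the sum as row sums times the [b k k], minus half the entries of [P] times
   the pairwise slacks; the latter vanish on the diagonal, and off it the entries are
   nonpositive. *)
have cert_ge0 : 0 <= \sum_k \sum_j P k j * b k j.
  have -> : \sum_k \sum_j P k j * b k j = \sum_k (\sum_j P k j) * b k k -
      (\sum_k \sum_j P k j * (b k k + b j j - b k j - b j k)) / 2.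
    have E1 : \sum_k \sum_j P k j * (b k k + b j j - b k j - b j k) =
        \sum_k \sum_j P k j * b k k + \sum_k \sum_j P k j * b j j -
        \sum_k \sum_j P k j * b k j - \sum_k \sum_j P k j * b j k.
      rewrite -big_split -!sumrB; apply: eq_bigr => k _.
      by rewrite -big_split -!sumrB; apply: eq_bigr => j _ /=; ring.
    have E2 : \sum_k \sum_j P k j * b j j = \sum_k \sum_j P k j * b k k.
      rewrite exchange_big; apply: eq_bigr => k _; apply: eq_bigr => j _.
      by rewrite PC.
    have E3 : \sum_k \sum_j P k j * b j k = \sum_k \sum_j P k j * b k j.
      rewrite exchange_big; apply: eq_bigr => k _; apply: eq_bigr => j _.
      by rewrite PC.
    have -> : \sum_k (\sum_j P k j) * b k k = \sum_k \sum_j P k j * b k k.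
      by apply: eq_bigr => k _; rewrite mulr_suml.
    rewrite E1 E2 E3; lra.
  apply: addr_ge0.
    by apply: sumr_ge0 => k _; rewrite P_rowsum !mulr_ge0.
  rewrite -mulNr mulr_ge0 ?invr_ge0 // oppr_ge0.
  apply: sumr_le0 => k _; apply: sumr_le0 => j _.
  case: (ltngtP k j) => [kj|jk|/val_inj ->].
  - by rewrite mulr_le0_ge0 ?bI // PC P_offdiag.
  - by rewrite mulr_le0_ge0 ?bI // P_offdiag.
  - by rewrite (_ : b j j + _ - _ - _ = 0) ?mulr0 //; ring.
rewrite b_cert in cert_ge0.
have /= <- := rE ord_max; rewrite -!inner_norm -/z.
clearbody z.
(* Completing the square: combined with [cert_ge0], this gives [N^2 |r|^2 <= 4 |z|^2] for the last
   residual [r], where [N = n.+1]. *)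
have := inner_ge0 (z - (n.+1%:R / 2) *: r ord_max).
have n0 : 0 < n.+1%:R :> R by [].
rewrite innerBr !innerBl !innerZr !innerZl.
rewrite (innerC _ z) ler_pdivlMr ?exprn_gt0 //.
move: cert_ge0; rewrite (innerC _ z); lra.
Qed.

End Sufficiency.

(** * The polynomials of the extremal trajectory *)

(** Course-of-values recursion by growing the list of earlier values. It yields both the polynomials
    [p_k] and, later, the perturbations [rho]. *)
Lemma triangular_recursion (R : nzRingType) (V : lmodType R) (M : nat -> nat -> R)
    (F : nat -> V -> V) :
  exists s : nat -> V, forall k, s k = F k (\sum_(j < k) M k j *: s j).
Proof.
pose step (t : seq V) := F (size t) (\sum_(j < size t) M (size t) j *: t`_j).
pose L k := iter k (fun t => rcons t (step t)) [::].
have szL k : size (L k) = k by elim: k => //= k IH; rewrite size_rcons IH.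
have LE j k : (j < k)%N -> (L k)`_j = step (L j).
  elim: k => // k IH; rewrite ltnS leq_eqVlt => /predU1P[->|jk].
    by rewrite /= nth_rcons szL ltnn eqxx.
  by rewrite /= nth_rcons szL jk IH.
exists (fun k => step (L k)) => k; rewrite {1}/step szL; congr (F k _).
by apply: eq_bigr => j _; rewrite LE.
Qed.

Section WorstCasePolynomials.
Variables (R : comNzRingType) (M : nat -> nat -> R).

Fact iterate_poly_key :
  exists p : nat -> {poly R},
    forall k, p k = 1 - (1 - 'X) * (\sum_(j < k) M k j *: p j).
Proof. exact: (triangular_recursion M (fun _ q => 1 - (1 - 'X) * q)). Qed.

(* y_k = p_k(U) y_0 along the trajectory of a linear operator T = U. *)
Definition iterate_poly : nat -> {poly R} := projT1 (cid iterate_poly_key).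

Local Notation p := iterate_poly.

Lemma iterate_polyE k : p k = 1 - (1 - 'X) * (\sum_(j < k) M k j *: p j).
Proof. exact: (projT2 (cid iterate_poly_key)). Qed.

Definition iterate_mx n : 'M[R]_n := \matrix_(k, i) (p k)`_i.

Definition coef_mx n : 'M[R]_n := \matrix_(k, j) M k j.

Definition triu1 n : 'M[R]_n := \matrix_(i, j) (i <= j)%:R.

Lemma triu1_sym n : triu1 n + (triu1 n)^T = const_mx 1 + 1%:M.
Proof.
apply/matrixP => i j; rewrite !mxE -val_eqE /=.
by case: ltngtP => _; rewrite ?addr0 ?add0r.
Qed.

Lemma iterate_poly1 k : (p k).[1] = 1.
Proof. by rewrite iterate_polyE !hornerE subrr mul0r subr0. Qed.

Lemma size_iterate_poly k : (size (p k) <= k.+1)%N.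
Proof.
elim/ltn_ind: k => k IH; rewrite iterate_polyE.
apply: leq_trans (size_polyD _ _) _; rewrite size_polyN size_poly1 geq_max /=.
apply: leq_trans (size_polyMleq _ _) _.
have s1 : (size (1 - 'X : {poly R})%R <= 2)%N.
  by rewrite -opprB size_polyN size_XsubC.
have s2 : (size (\sum_(j < k) M k j *: p j)%R <= k)%N.
  apply: leq_trans (size_sum _ _ _) _; apply/bigmax_leqP => j _.
  by apply: leq_trans (size_scale_leq _ _) _; apply: leq_trans (IH _ _) _.
by rewrite -[k.+1]/(2 + k).-1 -!subn1 leq_sub2r // leq_add.
Qed.

Lemma coef_iterate_poly_gt k i : (k < i)%N -> (p k)`_i = 0.
Proof. by move=> ki; rewrite nth_default // (leq_trans (size_iterate_poly k)). Qed.

Lemma iterate_mx_rowsum k n : (k < n)%N -> \sum_(i < n) (p k)`_i = 1.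
Proof.
move=> kn; rewrite -(iterate_poly1 k) (@horner_coef_wide _ n); last first.
  exact: leq_trans (size_iterate_poly k) kn.
by apply: eq_bigr => i _; rewrite expr1n mulr1.
Qed.

(** Only the last term of the recursion reaches degree [k.+1]. Nonvanishing of one leading
    coefficient thus passes down to all earlier ones, which will make [S] invertible. *)
Lemma lead_iterate_poly k : (p k.+1)`_k.+1 = M k.+1 k * (p k)`_k.
Proof.
rewrite iterate_polyE mulrBl mul1r !coefB coefXM /= coef1 !coef_sum sub0r opprB.
rewrite [X in _ - X]big1 => [|j _]; last first.
  by rewrite coefZ coef_iterate_poly_gt ?mulr0.
rewrite subr0 big_ord_recr /= big1 ?add0r ?coefZ // => j _.
by rewrite coefZ coef_iterate_poly_gt ?mulr0.
Qed.

(** The recursion divided by [1 - 'X]: division turns coefficients into partial sums, and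
    [1 / (1 - 'X)] has all coefficients 1. *)
Lemma iterate_poly_partial_sum k i :
  \sum_(l < i.+1) (p k)`_l + \sum_(j < k) M k j * (p j)`_i = 1.
Proof.
have -> : \sum_(j < k) M k j * (p j)`_i = (\sum_(j < k) M k j *: p j)`_i.
  by rewrite coef_sum; apply: eq_bigr => j _; rewrite coefZ.
rewrite iterate_polyE; move: (\sum_(j < k) _) => q.
elim: i => [|i IH].
  by rewrite big_ord1 mulrBl mul1r !coefB coefXM coef1 subr0 subrK.
rewrite big_ord_recr /= -[RHS]IH mulrBl mul1r !coefB coefXM coef1 /=.
by rewrite -addrA; congr (_ + _); rewrite sub0r opprB subrK.
Qed.

Hypothesis M_lower : forall k j, (k <= j)%N -> M k j = 0.

Lemma sum_lower (V : lmodType R) (s : nat -> V) k n : (k <= n)%N ->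
  \sum_(j < n) M k j *: s j = \sum_(j < k) M k j *: s j.
Proof.
move=> kn; rewrite -!(big_mkord xpredT (fun j => M k j *: s j)).
rewrite (big_cat_nat (leq0n k) kn) /= -[RHS]addr0; congr (_ + _).
by rewrite big_nat big1 // => j /andP[kj _]; rewrite M_lower ?scale0r.
Qed.

Lemma iterate_mx_triu1 n :
  iterate_mx n *m triu1 n + coef_mx n *m iterate_mx n = const_mx 1.
Proof.
apply/matrixP => k i; rewrite !mxE -(iterate_poly_partial_sum k i); congr (_ + _).
  under eq_bigr do rewrite !mxE.
  under [RHS]eq_bigr do rewrite -[(p k)`_ _]mulr1.
  rewrite (big_ord_widen_cond n predT (fun l => (p k)`_l * 1)) // [RHS]big_mkcond /=.
  by apply: eq_bigr => l _; rewrite ltnS; case: leqP => _; rewrite ?mulr0.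
under eq_bigr do rewrite !mxE.
exact: (@sum_lower R^o (fun j => (p j)`_i) k n (ltnW (ltn_ord k))).
Qed.

End WorstCasePolynomials.

(** * The extremal isometry and the certificate matrix [(S S^T)^-1] *)

Section CertificateMatrix.
Variables (R : realType) (n : nat) (M S : 'M[R]_n.+1).

Local Notation one := (const_mx 1 : 'cV[R]_n.+1).
Local Notation elast := (delta_mx ord_max 0 : 'cV[R]_n.+1).
Local Notation J := (triu1 R n.+1).

Lemma const_mx1E : const_mx 1 = one *m one^T.
Proof.
by apply/matrixP => i j; rewrite !mxE big_ord1 !mxE mulr1.
Qed.

(* The rows of [orbit_mx] are the points [U^i y_0] of the orbit of the extremal
   isometry [U]; as [orbit_mx - 1] is skew, [isometry_mx] (acting on row vectors
   from the right) is a Cayley transform, hence orthogonal. *)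
Definition orbit_mx : 'M[R]_n.+1 := 2 *: J - const_mx 1.

Definition isometry_mx : 'M[R]_n.+1 := 1%:M - 2 *: invmx orbit_mx.

Lemma orbit_mx_sym : orbit_mx + orbit_mx^T = 2%:M.
Proof.
apply/matrixP => i j; rewrite !mxE -val_eqE /=.
case: ltngtP => _; rewrite ?mulr0n ?mulr1n; ring.
Qed.

(** The symmetric part is the identity, so [v V v^T = |v|^2] for every row [v] and the kernel is
    trivial. *)
Lemma orbit_mx_unit : orbit_mx \in unitmx.
Proof.
rewrite -row_free_unit -kermx_eq0; apply/eqP/row_matrixP => i.
rewrite row0; set v := row i _.
have v0 : v *m orbit_mx = 0 by rewrite -row_mul mulmx_ker row0.
clearbody v.
have : v *m (orbit_mx + orbit_mx^T) *m v^T = 0.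
  rewrite mulmxDr v0 add0r -mulmxA -trmx_mul v0 trmx0 mulmx0 //.
rewrite orbit_mx_sym mul_mx_scalar -scalemxAl => /eqP; rewrite scaler_eq0 pnatr_eq0.
move=> /= /eqP /matrixP /(_ 0 0); rewrite !mxE.
under eq_bigr do rewrite mxE -expr2.
move=> /psumr_eq0P v_sq; apply/rowP => j; rewrite [RHS]mxE.
by apply/eqP; rewrite -sqrf_eq0 v_sq // => k _; rewrite sqr_ge0.
Qed.

Lemma orbit_mx_isometry : orbit_mx *m (1%:M - isometry_mx) = 2%:M.
Proof. by rewrite subKr -scalemxAr mulmxV ?orbit_mx_unit // scalemx1. Qed.

Lemma isometry_mx_orthogonal : isometry_mx *m isometry_mx^T = 1%:M.
Proof.
have Vu := orbit_mx_unit.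
apply: (can_inj (mulKmx Vu)); apply: (can_inj (mulmxK (_ : orbit_mx^T \in unitmx))).
  by rewrite unitmx_tr.
(* With [V = orbit_mx], orthogonality now reads [V^T V = V V^T], which holds because
   [V^T = 2 - V]. *)
have VW : orbit_mx *m isometry_mx = - orbit_mx^T.
  rewrite mulmxBr mulmx1 -scalemxAr mulmxV // scalemx1 -orbit_mx_sym.
  by rewrite opprD addrA subrr sub0r.
rewrite mulmxA VW -mulmxA -trmx_mul VW mulmx1 linearN /= trmxK mulmxN mulNmx opprK.
have -> : orbit_mx^T = 2%:M - orbit_mx by rewrite -orbit_mx_sym addrAC subrr add0r.
by move: orbit_mx => V; rewrite mulmxBl mulmxBr mul_mx_scalar mul_scalar_mx.
Qed.

Hypothesis S_triu1 : S *m J + M *m S = const_mx 1.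
Hypothesis S_rowsum : S *m one = one.

(** Row [k] is the iterate [p_k(U) y_0] of the extremal run, with [y_0] the all-ones vector. *)
Definition trajectory_mx := S *m orbit_mx.

Lemma trajectory_mxE : trajectory_mx = const_mx 1 - 2 *: (M *m S).
Proof.
have S_ones : S *m const_mx 1 = const_mx 1 :> 'M[R]_n.+1.
  by rewrite const_mx1E mulmxA S_rowsum.
have -> : trajectory_mx = 2 *: (S *m J) - const_mx 1.
  by rewrite /trajectory_mx mulmxBr -scalemxAr S_ones.
rewrite -(addrK (M *m S) (S *m J)) S_triu1 scalerBr.
move: (const_mx 1) (M *m S) => C B.
by rewrite addrAC (scaler_nat 2 C) mulr2n addrK.
Qed.

Lemma trajectory_mx_residual : trajectory_mx *m (1%:M - isometry_mx) = 2 *: S.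
Proof. by rewrite -mulmxA orbit_mx_isometry mul_mx_scalar. Qed.

Hypothesis S_unit : S \in unitmx.
Hypothesis S_last : S^T *m elast = n.+1%:R^-1 *: one.

Definition cert_mx : 'M[R]_n.+1 := (invmx S)^T *m invmx S.

Lemma cert_mx_sym : cert_mx^T = cert_mx.
Proof. by rewrite trmx_mul trmxK. Qed.

(** [S] fixes the all-ones vector, and [S^T] sends [n.+1 *: elast] to it. *)
Lemma cert_mx_one : cert_mx *m one = n.+1%:R *: elast.
Proof.
rewrite /cert_mx -mulmxA -{1}S_rowsum mulKmx //.
have -> : one = n.+1%:R *: (S^T *m elast).
  by rewrite S_last scalerA divff ?scale1r // pnatr_eq0.
by rewrite -scalemxAr mulmxA -trmx_mul mulmxV // trmx1 mul1mx.
Qed.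

(** Conjugated by [S], the equation becomes [1 + (C - J) + (C - J^T) = C] with [C] the all-ones
    matrix, which is [triu1_sym]. *)
Lemma cert_mx_lyapunov : cert_mx + cert_mx *m M + M^T *m cert_mx
  = n.+1%:R ^+ 2 *: delta_mx ord_max ord_max.
Proof.
have STu : S^T \in unitmx by rewrite unitmx_tr.
have STV : S^T *m (invmx S)^T = 1%:M by rewrite -trmx_mul mulVmx // trmx1.
apply: (can_inj (mulKmx STu)); apply: (can_inj (mulmxK S_unit)).
have -> : S^T *m (n.+1%:R ^+ 2 *: delta_mx ord_max ord_max) *m S = const_mx 1.
  have -> : delta_mx ord_max ord_max = elast *m elast^T.
    by rewrite trmx_delta mul_delta_mx.
  rewrite -scalemxAr -scalemxAl mulmxA S_last -mulmxA -[X in _ *m X]trmxK trmx_mul trmxK S_last.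
  rewrite linearZ /= -scalemxAl -scalemxAr !scalerA -const_mx1E -mulrA -expr2.
  by rewrite -exprMn divff ?pnatr_eq0 // expr1n scale1r.
have SMS : S^T *m (cert_mx *m M) *m S = const_mx 1 - J.
  rewrite /cert_mx !mulmxA STV mul1mx -mulmxA.
  have -> : M *m S = const_mx 1 - S *m J by rewrite -S_triu1 addrAC subrr add0r.
  by rewrite mulmxBr mulKmx // const_mx1E mulmxA -{1}S_rowsum mulKmx.
have SMS' : S^T *m (M^T *m cert_mx) *m S = const_mx 1 - J^T.
  have -> : S^T *m (M^T *m cert_mx) *m S = (S^T *m (cert_mx *m M) *m S)^T.
    rewrite trmx_mul [(S^T *m _)^T]trmx_mul [(cert_mx *m _)^T]trmx_mul.
    by rewrite trmxK cert_mx_sym -!mulmxA.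
  by rewrite SMS linearB /= trmx_const.
rewrite !mulmxDr !mulmxDl SMS SMS' /cert_mx mulmxA STV mul1mx mulVmx //.
have := triu1_sym R n.+1; move: (const_mx 1) J^T J 1%:M => C B A I AB.
apply/matrixP => i j; move/matrixP: AB => /(_ i j); rewrite !mxE => AB; lra.
Qed.

(* [rho] is the effect of a perturbation [eta] of [T y_k] on the residuals; its
   effect on the last residual, measured along [y_0], is governed by row [k] of the
   certificate matrix. *)
Lemma cert_mx_perturbation (rho : 'M[R]_n.+1) k (eta : 'rV[R]_n.+1) :
  rho + M *m rho *m (1%:M - isometry_mx) = delta_mx k 0 *m eta ->
  (cert_mx *m trajectory_mx *m isometry_mx *m eta^T) k 0
    = - n.+1%:R * \sum_i rho ord_max i.
Proof.
have := (cert_mx_sym, cert_mx_one, cert_mx_lyapunov, isometry_mx_orthogonal).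
move: trajectory_mx_residual trajectory_mxE.
move: cert_mx trajectory_mx isometry_mx => P Y W YR YE [[[PT P1] PL] WW] rhoE.
have <- : (elast^T *m rho *m one) 0 0 = \sum_i rho ord_max i.
  rewrite mxE; apply: eq_bigr => i _.
  rewrite mxE (bigD1 ord_max) //= !mxE !eqxx /= mul1r mulr1 big1 ?addr0 // => j.
  by rewrite !mxE => /negPf->; rewrite mul0r.
have tr1 (a : 'cV[R]_n.+1) (b : 'rV_n.+1) : \tr (a *m b) = (b *m a) 0 0.
  by rewrite mxtrace_mulC /mxtrace big_ord1.
(* As a trace, the entry admits the substitution [rhoE]. Cyclicity brings [1 - W] next to [W^T Y^T],
   which yields [-2 S^T], and the Lyapunov equation eliminates [P M]; everything but the last row of
   [rho] cancels. *)
have -> : (P *m Y *m W *m eta^T) k 0 = \tr ((P *m Y *m W)^T *m (delta_mx k 0 *m eta)).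
  move: (P *m Y *m W) => A; rewrite mulmxA tr1 -colE !mxE.
  by apply: eq_bigr => i _; rewrite !mxE mulrC.
rewrite -rhoE (mulmxDr _ rho) mxtraceD.
have WWT : (1%:M - W) *m W^T = W^T - 1%:M by rewrite mulmxBl mul1mx WW.
have YRT : (W^T - 1%:M) *m Y^T = - (2 *: S^T).
  by rewrite -linearZ /= -YR trmx_mul linearB /= trmx1 -mulNmx opprB.
have PM : P *m M = n.+1%:R ^+ 2 *: (elast *m elast^T) - P - M^T *m P.
  rewrite trmx_delta mul_delta_mx -PL; move: (P *m M) (M^T *m P) => B C.
  by apply/matrixP => i j; rewrite !mxE; ring.
have -> : \tr ((P *m Y *m W)^T *m (M *m rho *m (1%:M - W))) =
   \tr (2 *: (S^T *m P *m rho)) + \tr (2 *: (S^T *m M^T *m P *m rho))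
   - \tr ((2 * n.+1%:R) *: (one *m (elast^T *m rho))).
  rewrite mulmxA mxtrace_mulC -!mxtraceD -raddfB /=; congr (\tr _).
  rewrite !trmx_mul PT !mulmxA WWT YRT.
  have SPM : S^T *m P *m M *m rho = n.+1%:R *: (one *m elast^T *m rho)
      - S^T *m P *m rho - S^T *m M^T *m P *m rho.
    rewrite -(mulmxA S^T) PM !mulmxBr -scalemxAr (mulmxA S^T elast) S_last.
    rewrite -scalemxAl scalerA expr2 mulfK ?pnatr_eq0 //.
    by rewrite !(mulmxBl _ _ rho) -scalemxAl !mulmxA.
  rewrite !mulNmx -!scalemxAl SPM.
  move: (one *m _ *m _) (S^T *m P *m rho) (S^T *m _ *m _ *m _) => A B C.
  by apply/matrixP => i j; rewrite !mxE; ring.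
have -> : \tr ((P *m Y *m W)^T *m rho) =
   \tr (n.+1%:R *: (one *m (elast^T *m rho))) - \tr (2 *: (S^T *m P *m rho))
   - \tr (2 *: (S^T *m M^T *m P *m rho)).
  rewrite -!raddfB /=; congr (\tr _).
  have -> : n.+1%:R *: (one *m (elast^T *m rho)) = const_mx 1 *m P *m rho.
    rewrite const_mx1E -(mulmxA one) -[one^T *m P]trmxK trmx_mul trmxK PT P1.
    by rewrite linearZ /= -scalemxAr -scalemxAl mulmxA.
  rewrite !trmx_mul PT mulmxA.
  have -> : W^T *m Y^T = const_mx 1 - 2 *: S^T - 2 *: (S^T *m M^T).
    rewrite -(subrK 1%:M W^T) mulmxDl mul1mx YRT YE.
    rewrite [(_ - _)^T]linearB /= trmx_const [(2 *: _)^T]linearZ /= trmx_mul.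
    by rewrite addrC addrAC.
  by rewrite !mulmxBl -!scalemxAl.
rewrite !mxtraceZ tr1.
move: (\tr _) (\tr _) (_ 0 0) => a b c; ring.
Qed.

End CertificateMatrix.

(** * Necessity of the certificate conditions *)

(** [B] must not depend on [s] or [e]: it enters the choice of the folding hyperplane, on which the
    perturbation itself depends. *)
Lemma triangular_recursion_bound (R : realType) (V : normedModType R)
    (M : nat -> nat -> R) n :
  exists2 B : R, 0 <= B & forall (e : R) (s : nat -> V), 0 <= e ->
    (forall a, `|s a| <= e + 2 * `|\sum_(b < a) M a b *: s b|) ->
    forall a, (a < n)%N -> `|\sum_(b < a) M a b *: s b| <= B * e.
Proof.
elim: n => [|n [B B0 IH]]; first by exists 0.
exists (B + \sum_(b < n) `|M n b| * (1 + 2 * B)).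
  by rewrite addr_ge0 // sumr_ge0 // => b _; rewrite mulr_ge0 // addr_ge0 ?mulr_ge0.
move=> e s e0 sE a; rewrite ltnS leq_eqVlt mulrDl => /predU1P[->|an]; last first.
  apply: le_trans (IH e s e0 sE a an) _; rewrite lerDl mulr_ge0 // sumr_ge0 // => b _.
  by rewrite mulr_ge0 // addr_ge0 ?mulr_ge0.
rewrite -[leLHS]add0r lerD ?mulr_ge0 //.
apply: le_trans (ler_norm_sum _ _ _) _; rewrite mulr_suml; apply: ler_sum => b _.
rewrite normrZ -mulrA ler_wpM2l // mulrDl mul1r.
apply: le_trans (sE b) _; rewrite lerD2l -mulrA ler_wpM2l //.
exact: IH.
Qed.

(** * From step sizes to cumulated steps *)

Section CumulatedMatrix.
Variables (R : realType) (n : nat) (H : 'M[R]_n).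

(* Since y_{i+1} - y_i = - \sum_j h_{i+1,j+1} (y_j - T y_j), summing over i < k gives
   y_k = y_0 - \sum_j [cumulated k j] (y_j - T y_j). *)
Definition cumulated (k j : nat) : R :=
  \sum_(i < n | (i < k)%N) \sum_(l < n | (l == j :> nat) && (l <= i)%N) H i l.

Lemma cumulated_lower k j : (k <= j)%N -> cumulated k j = 0.
Proof.
move=> kj; rewrite /cumulated big1 // => i ik; rewrite big1 // => l /andP[/eqP lj li].
by move: (leq_trans ik kj); rewrite -lj ltnNge li.
Qed.

Lemma cumulatedS (k : 'I_n) j :
  cumulated k.+1 j = cumulated k j + \sum_(l < n | (l == j :> nat) && (l <= k)%N) H k l.
Proof.
rewrite /cumulated (bigD1 k) //= addrC; congr (_ + _); apply: eq_bigl => i.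
by rewrite ltnS ltn_neqAle andbC.
Qed.

Lemma cumulatedS_sum (V : lmodType R) (r : nat -> V) (k : 'I_n) :
  \sum_(j < n.+1) cumulated k.+1 j *: r j = \sum_(j < n.+1) cumulated k j *: r j
    + \sum_(j < n | (j <= k)%N) H k j *: r j.
Proof.
under eq_bigr do rewrite cumulatedS scalerDl.
rewrite big_split /=; congr (_ + _).
under eq_bigr do rewrite scaler_suml.
rewrite (exchange_big_dep (fun l : 'I_n => (l <= k)%N)) /=; last first.
  by move=> j l _ /andP[_ ->].
apply: eq_bigr => l lk.
rewrite (big_pred1 (widen_ord (leqnSn n) l)) // => j /=.
by rewrite lk andbT -val_eqE eq_sym.
Qed.

Lemma iterates_cumulated (X : hilbertType R) (T : X -> X) (y : nat -> X) :
  iterates n.+1 H T y <-> forall k, (k <= n)%N ->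
    y k = y 0%N - \sum_(j < n.+1) cumulated k j *: (y j - T (y j)).
Proof.
split=> [yE|yE k]; last first.
  rewrite (yE k.+1) // (cumulatedS_sum (fun j => y j - T (y j))).
  rewrite [X in _ = X - _]yE ?(ltnW (ltn_ord k)) //.
  by rewrite opprD addrA.
elim=> [|k IH] kn.
  by rewrite big1 ?subr0 // => j _; rewrite cumulated_lower ?scale0r.
have /= -> := yE (Ordinal kn).
have /= -> := cumulatedS_sum (fun j => y j - T (y j)) (Ordinal kn).
by rewrite [in LHS]IH ?(ltnW kn) // opprD addrA.
Qed.

End CumulatedMatrix.

(** * Nonexpansive test operators: the extremal isometry and folds *)

Section TestOperators.
Variables (R : realType) (n : nat).
Local Notation X := (euclidean R n.+1).
Local Notation W := (isometry_mx R n).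
Implicit Types u v w : X.

Lemma dotvE u v : dotv u v = (u *m v^T) 0 0.
Proof. by rewrite mxE; apply: eq_bigr => i _; rewrite mxE. Qed.

Lemma sqr_euclidean_norm u : `|u| ^+ 2 = dotv u u.
Proof. by rewrite -dotv_norm. Qed.

Lemma dotv_isometry u v : dotv (u *m W : X) (v *m W : X) = dotv u v.
Proof.
rewrite !dotvE trmx_mul -mulmxA (mulmxA W) isometry_mx_orthogonal.
by rewrite mul1mx.
Qed.

Lemma norm_isometry u : `|(u *m W : X)| = `|u|.
Proof. by rewrite !euclidean_normE dotv_isometry. Qed.

(* Reflects the half-space [0 < <u, v>] onto its complement. *)
Definition fold v u : X := u - (2 * Num.max 0 (dotv u v) / dotv v v) *: v.

Lemma fold_nonexpansive v : nonexpansive (fold v : X -> X).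
Proof.
move=> u w; have [v0|v0] := eqVneq v 0.
  by rewrite /fold v0 !scaler0 !subr0.
rewrite -(@ler_pXn2r _ 2) ?nnegrE // !sqr_euclidean_norm /fold.
have q0 := dotv_gt0 v0; set q := dotv v v in q0 *.
set a := Num.max 0 (dotv u v); set b := Num.max 0 (dotv w v).
have -> : u - (2 * a / q) *: v - (w - (2 * b / q) *: v)
    = (u - w) - (2 * (a - b) / q) *: v.
  by apply/rowP => i; rewrite !mxE; ring.
(* The positive part is firmly nonexpansive on the line; the expanded square below reduces to
   this. *)
have mono : (a - b) ^+ 2 <= (a - b) * (dotv u v - dotv w v).
  rewrite /a /b; case: (lerP 0 (dotv u v)) => hu; case: (lerP 0 (dotv w v)) => hw; nra.
move: mono; rewrite -dotvBl; move: (u - w) (a - b) => d c mono.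
rewrite dotvBr !dotvBl !dotvZr !dotvZl (dotvC v) -/q -subr_ge0.
rewrite (_ : _ - _ = 4 / q * (c * dotv d v - c ^+ 2)); last first.
  by field; rewrite gt_eqF.
by rewrite mulr_ge0 ?subr_ge0 // divr_ge0 // ltW.
Qed.

Lemma nonexpansive_isometry (T : X -> X) :
  nonexpansive T -> nonexpansive ((fun u => T u *m W) : X -> X).
Proof.
move=> Tne u w; apply: le_trans (Tne u w).
by rewrite -mulmxBl norm_isometry.
Qed.

End TestOperators.

(** * What the guarantee implies for the last row of [S] and the signs of [P] *)

Section Necessity.
Variables (R : realType) (n : nat) (H : 'M[R]_n).
Hypothesis H_star : Hstar R n.+1 H.
Local Notation X := (euclidean R n.+1).
Local Notation W := (isometry_mx R n).
Local Notation M := (cumulated H).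
Local Notation S := (iterate_mx M n.+1).
Local Notation Y := (trajectory_mx S).
Local Notation one := (const_mx 1 : 'cV[R]_n.+1).

Lemma cumulated_triu1 m :
  iterate_mx M m *m triu1 R m + coef_mx M m *m iterate_mx M m = const_mx 1.
Proof. by apply: iterate_mx_triu1; exact: cumulated_lower. Qed.

Lemma iterate_mx_one m : iterate_mx M m *m (const_mx 1 : 'cV_m) = const_mx 1.
Proof.
apply/colP => k; rewrite !mxE -[RHS](iterate_mx_rowsum M (ltn_ord k)).
by apply: eq_bigr => i _; rewrite !mxE mulr1.
Qed.

Lemma trajectory_row (k : 'I_n.+1) :
  row k Y = const_mx 1 - \sum_(j < n.+1) M k j *: (2 *: row j S).
Proof.
rewrite (trajectory_mxE (cumulated_triu1 _) (iterate_mx_one _)).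
apply/rowP => i; rewrite !mxE summxE mulr_sumr; congr (_ - _).
by apply: eq_bigr => j _; rewrite !mxE; ring.
Qed.

Lemma trajectory_row0 : row 0 Y = const_mx 1.
Proof.
by rewrite trajectory_row big1 ?subr0 // => j _; rewrite cumulated_lower ?scale0r.
Qed.

Lemma trajectory_residual (k : 'I_n.+1) : row k Y - row k Y *m W = 2 *: row k S.
Proof.
by rewrite -[X in X - _]mulmx1 -mulmxBr -row_mul trajectory_mx_residual linearZ.
Qed.

Lemma dotv_const_mx1 : dotv (const_mx 1 : X) (const_mx 1) = n.+1%:R.
Proof.
rewrite /dotv; under eq_bigr do rewrite !mxE mulr1.
by rewrite sumr_const card_ord.
Qed.

Lemma dotv_row_iterate (k : 'I_n.+1) : dotv (row k S : X) (const_mx 1) = 1.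
Proof.
rewrite /dotv -[RHS](iterate_mx_rowsum M (ltn_ord k)).
by apply: eq_bigr => i _; rewrite !mxE mulr1.
Qed.

(* [rho] is the deviation of the residuals from those of the extremal isometry. *)
Lemma Hstar_test (T : X -> X) (rho : nat -> X) :
  nonexpansive T -> T 0 = 0 ->
  (forall a : 'I_n.+1, T (row a Y - \sum_(b < n.+1) M a b *: rho b)
     = row a Y - \sum_(b < n.+1) M a b *: rho b - (2 *: row a S + rho a)) ->
  dotv (2 *: row ord_max S + rho n) (2 *: row ord_max S + rho n) <= 4 / n.+1%:R.
Proof.
move=> Tne T0 TE.
(* Only indices up to [n] matter; [inord] fills in arbitrary values beyond. *)
pose y k : X := row (inord k) Y - \sum_(b < n.+1) M k b *: rho b.
have yE (a : 'I_n.+1) : y a = row a Y - \sum_(b < n.+1) M a b *: rho b.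
  by rewrite /y inord_val.
have rE (a : 'I_n.+1) : y a - T (y a) = 2 *: row a S + rho a.
  by rewrite yE TE opprD addrA subrr sub0r opprK.
have y0E : y 0%N = const_mx 1.
  rewrite (yE 0) trajectory_row0 big1 ?subr0 // => b _.
  by rewrite cumulated_lower ?scale0r.
have it : iterates n.+1 H T y.
  apply/iterates_cumulated => k kn; rewrite y0E.
  rewrite (yE (Ordinal (kn : (k < n.+1)%N))) trajectory_row.
  under [in RHS]eq_bigr do rewrite rE scalerDr.
  by rewrite big_split opprD addrA.
have [_ /(_ X T 0 y Tne T0 it)] := H_star.
(* Since [|y_0|^2 = n.+1], the guarantee has right-hand side [4 / n.+1]. *)
rewrite /= (rE ord_max) subr0 y0E !sqr_euclidean_norm dotv_const_mx1.
by rewrite expr2 invfM mulrA mulfK ?pnatr_eq0.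
Qed.

(** Running the bare isometry gives [|u|^2 <= 1 / n.+1], while the entries of [u] sum to 1: this is
    the equality case of Cauchy-Schwarz against the all-ones vector. *)
Lemma iterate_mx_last (i : 'I_n.+1) : S ord_max i = n.+1%:R^-1.
Proof.
set u : X := row ord_max S; set c : X := n.+1%:R^-1 *: const_mx 1.
suff /rowP/(_ i) : u = c by rewrite !mxE mulr1.
apply/eqP; rewrite -subr_eq0 -dotv_eq0 eq_le dotv_ge0 andbT.
have Tne : nonexpansive ((fun u => u *m W) : X -> X).
  by apply: (@nonexpansive_isometry R n idfun) => v w.
have := @Hstar_test _ (fun=> 0) Tne (mul0mx _ _).
rewrite addr0 => /(_ _)/wrap[].
  move=> a; rewrite big1 => [|b _]; last by rewrite scaler0.
  by rewrite subr0 addr0 -trajectory_residual subKr.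
rewrite dotvZr dotvZl -/u => Hu.
rewrite dotvBr !dotvBl /c !dotvZr !dotvZl dotv_const_mx1 (dotvC (const_mx 1)).
rewrite dotv_row_iterate mulVf ?pnatr_eq0 // mulr1; move: Hu.
by move: (dotv u u) (n.+1%:R^-1) => p q; lra.
Qed.

Lemma iterate_mx_unit m : (m <= n.+1)%N -> iterate_mx M m \in unitmx.
Proof.
move=> mn; rewrite unitmxE det_trig; last first.
  apply/is_trig_mxP => i j ij; rewrite mxE coef_iterate_poly_gt //.
rewrite unitfE; apply/prodf_neq0 => i _; rewrite mxE.
have in_ : (i <= n)%N by rewrite -ltnS (leq_trans (ltn_ord i)).
have last_neq0 : (iterate_poly M n)`_n != 0.
  have := iterate_mx_last ord_max; rewrite mxE /= => ->.
  by rewrite invr_eq0 pnatr_eq0.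
suff lead_neq0 k : (i <= k)%N -> (iterate_poly M k)`_k != 0 ->
    (iterate_poly M i)`_i != 0 by exact: lead_neq0 in_ last_neq0.
elim: k => [|k IH]; first by rewrite leqn0 => /eqP ->.
rewrite leq_eqVlt ltnS => /predU1P[->//|ik].
by rewrite lead_iterate_poly mulf_eq0 negb_or => /andP[_]; exact: IH.
Qed.

Lemma iterate_mx_tr_last :
  S^T *m (delta_mx ord_max 0 : 'cV_n.+1) = n.+1%:R^-1 *: one.
Proof.
by rewrite -colE; apply/colP => i; rewrite !mxE mulr1 -(iterate_mx_last i) mxE.
Qed.

Let P := cert_mx S.

(* Fold the space along a hyperplane separating [y_k] (slightly above it) from [y_j]
   (at distance of order 1 below it), the other points lying slightly below it: only
   [T y_k] is affected by the fold, and the change of the last residual is given by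
   [cert_mx_perturbation]. *)
Lemma cert_mx_fold (j k : 'I_n.+1) : (j < k)%N ->
  exists K : R, forall e, 0 < e -> P k j <= e * K.
Proof.
move=> jk.
have [B B0 BP] := @triangular_recursion_bound R X M n.+1.
(* The coefficient of [e] in [(P s) k], whose nonnegativity is the conclusion; the constant term
   there is [- P k j]. *)
exists (P k k - 2 * B * \sum_(a < n.+1 | (k < a)%N) P k a) => e e0.
(* Prescribed inner products of the unperturbed iterates with [v]. Iterates before [k] do not move,
   so 0 suffices for them; later ones get a margin [2 * B * e] that absorbs their perturbation. *)
pose s : 'cV[R]_n.+1 := \col_a (if a == j then -1 else if a == k then e else
  if (k < a)%N then - (2 * B * e) else 0).
have Yu : Y \in unitmx by rewrite unitmx_mul orbit_mx_unit iterate_mx_unit.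
pose v : X := (invmx Y *m s)^T.
have Yv a : dotv (row a Y : X) v = s a 0.
  by rewrite dotvE trmxK -row_mul mulKVmx // mxE.
have v0 : v != 0.
  apply/eqP => v0; have := Yv j; rewrite v0 dotvE trmx0 mulmx0 !mxE eqxx => /eqP.
  by rewrite eq_sym oppr_eq0 oner_eq0.
have q0 := dotv_gt0 v0.
(* The fold moves [y_k] by [- (2 * e / dotv v v) *: v], so [eta] is the resulting change of the
   residual at [k]. *)
pose eta : X := (2 * e / dotv v v) *: (v *m W).
have [rho rhoE] := @triangular_recursion R X M
  (fun a x => (if a == k :> nat then eta else 0) - (x - x *m W)).
pose T (u : X) : X := (fold v u : X) *m W.
have Tne : nonexpansive T.
  by apply: nonexpansive_isometry; exact: fold_nonexpansive.
have dotv0l w : dotv (0 : X) w = 0 by rewrite -(subrr 0) dotvBl subrr.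
have T0 : T 0 = 0.
  by rewrite /T /fold dotv0l maxxx mulr0 mul0r scale0r subr0 mul0mx.
have norm_eta : `|eta| = 2 * e / dotv v v * `|v|.
  by rewrite normrZ norm_isometry ger0_norm // divr_ge0 ?mulr_ge0 // ltW.
have rho_lt a : (a < k)%N -> rho a = 0.
  elim/ltn_ind: a => a IH ak; rewrite rhoE ltn_eqF // big1 => [|b _].
    by rewrite mul0mx !subr0.
  by rewrite IH ?scaler0 // (ltn_trans _ ak).
have rho_bound a : (a < n.+1)%N ->
    `|\sum_(b < a) M a b *: rho b| <= B * `|eta|.
  apply: BP => // b; rewrite {1}rhoE; apply: le_trans (ler_normB _ _) _.
  apply: lerD; first by case: ifP; rewrite ?normr0.
  apply: le_trans (ler_normB _ _) _.
  by rewrite norm_isometry mulr2n mulrDl mul1r.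
have sumE a : (a < n.+1)%N ->
    \sum_(b < n.+1) M a b *: rho b = \sum_(b < a) M a b *: rho b.
  by move=> an; apply: sum_lower; [exact: cumulated_lower | exact: ltnW].
have sk : s k 0 = e by rewrite mxE eqxx (gtn_eqF jk : (k == j) = false).
have TE (a : 'I_n.+1) : T (row a Y - \sum_(b < n.+1) M a b *: rho b)
     = row a Y - \sum_(b < n.+1) M a b *: rho b - (2 *: row a S + rho a).
  rewrite rhoE -sumE ?ltn_ord // -trajectory_residual /T /fold.
  have := Yv a; have := rho_bound a (ltn_ord a); rewrite -sumE ?ltn_ord //.
  have : (a <= k)%N -> \sum_(b < n.+1) M a b *: rho b = 0.
    move=> ak; rewrite sumE ?ltn_ord // big1 // => b _; rewrite rho_lt ?scaler0 //.
    exact: leq_trans ak.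
  move: (\sum_(b < n.+1) _) (row a Y) => x t x0 xB tv.
  transitivity (t *m W - x *m W - (if a == k :> nat then eta else 0)); last first.
    by apply/rowP => i; rewrite !mxE; ring.
  case: ifP => ak.
    have {}ak : a = k by apply/val_inj/eqP.
    by rewrite x0 ?ak // !subr0 mul0mx subr0 tv ak sk max_r ?(ltW e0) // mulmxBl -scalemxAl.
  (* Away from [k] the perturbed iterate must stay on the side that the fold leaves fixed. *)
  suff tx : dotv (t - x) v <= 0.
    by rewrite max_l // mulr0 mul0r scale0r !subr0 mulmxBl.
  rewrite dotvBl tv mxE -val_eqE /=; case: eqP => [aj|_].
    rewrite x0 ?dotv0l ?subr0 ?lerN10 //.
    by rewrite aj ltnW.
  rewrite -val_eqE /= ak; case: ltnP => [ka|ka]; last by rewrite x0 // dotv0l subr0.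
  (* Cauchy-Schwarz, with [|x| <= B |eta| = 2 B e / |v|]. *)
  suff : `|dotv x v| <= 2 * B * e by rewrite ler_norml => /andP[? _]; lra.
  apply: le_trans (_ : `|x| * `|v| <= _).
    rewrite -(@ler_pXn2r _ 2) ?nnegrE ?mulr_ge0 // real_normK ?num_real //.
    by rewrite exprMn !sqr_euclidean_norm dotv_CauchySchwarz.
  apply: le_trans (ler_wpM2r (normr_ge0 _) xB) _.
  rewrite norm_eta -!mulrA -expr2 sqr_euclidean_norm mulVf ?gt_eqF // mulr1.
  by rewrite mulrCA.
have := Hstar_test Tne T0 TE.
set u : X := row ord_max S => rho_test.
(* As [4 |u|^2 = 4 / n.+1], the tested bound leaves [4 <u, rho n> + |rho n|^2 <= 0], and [u] is a
   positive multiple of the all-ones vector. *)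
have rho1 : \sum_i rho n 0 i <= 0.
  have uE : u = n.+1%:R^-1 *: const_mx 1.
    by apply/rowP => i; rewrite !mxE mulr1 -(iterate_mx_last i) mxE.
  have uu : dotv u u = n.+1%:R^-1.
    by rewrite {2}uE dotvZr dotv_row_iterate mulr1.
  have : dotv u (rho n) <= 0.
    move: rho_test; rewrite dotvDr !dotvDl !dotvZl !dotvZr uu (dotvC (rho n)).
    have := dotv_ge0 (rho n).
    by move: (dotv (rho n) _) (dotv u _) (n.+1%:R^-1) => p p' N; lra.
  rewrite uE dotvZl pmulr_rle0 ?invr_gt0 // => u_rho.
  suff -> : \sum_i rho n 0 i = dotv (const_mx 1 : X) (rho n) by [].
  by apply: eq_bigr => i _; rewrite mxE mul1r.
have rho_mx : (\matrix_a rho a) + coef_mx M n.+1 *m (\matrix_a rho a)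
    *m (1%:M - W) = delta_mx k 0 *m eta.
  apply/row_matrixP => a.
  have -> : row a (delta_mx k 0 *m eta) = if a == k :> nat then eta else 0.
    apply/rowP => i; rewrite !mxE big_ord1 !mxE eqxx andbT (val_eqE a k).
    by case: eqP; rewrite ?mul1r ?mul0r ?mxE.
  rewrite linearD /= row_mul rowK.
  have -> : row a (coef_mx M n.+1 *m (\matrix_a rho a)) = \sum_(b < a) M a b *: rho b.
    rewrite -sumE ?ltn_ord //; apply/rowP => i; rewrite !mxE summxE.
    by apply: eq_bigr => b _; rewrite !mxE.
  rewrite {1}rhoE; move: (\sum_(b < a) _) (isometry_mx R n) => x Z.
  by rewrite mulmxBr mulmx1 subrK.
have := cert_mx_perturbation (cumulated_triu1 _) (iterate_mx_one _)
  (iterate_mx_unit (leqnn _)) iterate_mx_tr_last rho_mx.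
have -> : \sum_i (\matrix_(a < n.+1) (rho a : 'rV_n.+1)) ord_max i = \sum_i rho n 0 i.
  by apply: eq_bigr => i _; rewrite !mxE.
(* Since [W W^T = 1] and [Y v^T = s], the sign found in [rho1] transfers to [(P s) k]. *)
have -> : P *m Y *m W *m eta^T = (2 * e / dotv v v) *: (P *m s).
  rewrite linearZ /= -scalemxAr trmx_mul mulmxA -(mulmxA _ W).
  by rewrite isometry_mx_orthogonal mulmx1 trmxK -mulmxA mulKVmx.
rewrite mxE => Ps; have {Ps} : 0 <= (P *m s) k 0.
  have : 0 <= - n.+1%:R * \sum_i rho n 0 i by rewrite mulNr -mulrN mulr_ge0 ?oppr_ge0.
  by rewrite -Ps pmulr_rge0 // divr_gt0 // mulr_gt0.
have -> : (P *m s) k 0 = - P k j + e * P k k - 2 * B * e * \sum_(a < n.+1 | (k < a)%N) P k a.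
  have pick (i : 'I_n.+1) : P k i = \sum_a P k a * (a == i)%:R.
    rewrite (bigD1 i) //= eqxx mulr1 big1 ?addr0 // => a /negPf ->.
    by rewrite mulr0.
  have -> : \sum_(a < n.+1 | (k < a)%N) P k a = \sum_a P k a * (k < a)%:R.
    rewrite big_mkcond; apply: eq_bigr => a _.
    by case: ifP; rewrite ?mulr1 ?mulr0.
  rewrite mxE (pick j) (pick k) -sumrN !mulr_sumr -big_split /= -sumrB.
  apply: eq_bigr => a _; rewrite [s a 0]mxE -!val_eqE /=; move: (P k a) => z.
  have [->|aj] := eqVneq (a : nat) j.
    by rewrite (ltn_eqF jk) ltnNge ltnW //=; ring.
  by case: (ltngtP k a) => ? /=; ring.
by move: (P k j) (P k k) (\sum_(_ < _ | _) _) => x z t h; lra.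
Qed.

(** Let [e] tend to 0 in [cert_mx_fold]; were the entry positive, [e = P k j / (2 * (|K| + 1))]
    would already be small enough for a contradiction. *)
Lemma cert_mx_offdiag (j k : 'I_n.+1) : (j < k)%N -> P k j <= 0.
Proof.
move=> /cert_mx_fold[K KP]; rewrite leNgt; apply/negP => Pkj.
have d0 : 0 < 2 * (`|K| + 1) by rewrite mulr_gt0 // ltr_wpDl.
have := KP _ (divr_gt0 Pkj d0); apply/negP; rewrite -ltNge.
apply: (@le_lt_trans _ _ (P k j / (2 * (`|K| + 1)) * `|K|)).
  by rewrite ler_wpM2l ?ler_norm // divr_ge0 // ltW.
rewrite -mulrA -[ltRHS]mulr1 ltr_pM2l // mulrC ltr_pdivrMr // mul1r.
by have := normr_ge0 K; lra.
Qed.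

End Necessity.

(** * H-certificates and the Lyapunov equation *)

Section PathSums.
Variables (R : realType) (n : nat) (H : 'M[R]_n).

(** [Qindex] with a free starting column, so that the first pair can be split off. *)
Let chain m (p : {ffun 'I_m -> 'I_n} * {ffun 'I_m -> 'I_n}) : bool :=
  [forall r, p.2 r <= p.1 r]%N &&
  [forall r : 'I_m, forall s : 'I_m, (s == r.+1 :> nat) ==> (p.1 r < p.2 s)%N].

Let cons m (i : 'I_n) (g : {ffun 'I_m -> 'I_n}) : {ffun 'I_m.+1 -> 'I_n} :=
  [ffun r => oapp g i (unlift ord0 r)].

Let cons0 m i (g : {ffun 'I_m -> 'I_n}) : cons i g ord0 = i.
Proof. by rewrite ffunE unlift_none. Qed.

Let consS m i (g : {ffun 'I_m -> 'I_n}) r : cons i g (lift ord0 r) = g r.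
Proof. by rewrite ffunE liftK. Qed.

Let QindexE m j (p : {ffun 'I_m.+1 -> 'I_n} * {ffun 'I_m.+1 -> 'I_n}) :
  Qindex j p = ((p.2 ord0).+1 == j) && chain p.
Proof.
rewrite /Qindex /chain; congr (_ && _); apply/forallP/idP => [/(_ ord0) //|pj r].
by apply/implyP => /eqP r0; rewrite (_ : r = ord0) //; apply/val_inj.
Qed.

Let chain_cons m i l (g1 g2 : {ffun 'I_m -> 'I_n}) :
  chain (cons i g1, cons l g2) =
    [&& (l <= i)%N, [forall s : 'I_m, (s == 0 :> nat) ==> (i < g2 s)%N] & chain (g1, g2)].
Proof.
apply/idP/idP.
  case/andP=> /forallP c1 /forallP c2; apply/and3P; split.
  - by have := c1 ord0; rewrite /= !cons0.
  - apply/forallP => s; apply/implyP => s0; have := forallP (c2 ord0) (lift ord0 s).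
    by rewrite /= cons0 consS /bump leq0n add1n eqSS => /implyP; apply.
  - apply/andP; split; first by apply/forallP => r; have := c1 (lift ord0 r); rewrite /= !consS.
    apply/forallP => r; apply/forallP => s; have := forallP (c2 (lift ord0 r)) (lift ord0 s).
    by rewrite /= !consS /bump !leq0n !add1n eqSS.
case/and3P=> li /forallP ig /andP[/forallP c1 /forallP c2].
apply/andP; split.
  by apply/forallP => r; case: (unliftP ord0 r) => [r'|] ->; rewrite /= ?consS ?cons0 ?c1.
apply/forallP => r; apply/forallP => s.
case: (unliftP ord0 s) => [s'|] -> //=; case: (unliftP ord0 r) => [r'|] -> /=.
  by rewrite !consS /bump !leq0n !add1n eqSS; exact: (forallP (c2 r')).
by rewrite consS cons0 /bump leq0n add1n eqSS.
Qed.

Let Q_cons m j : Q H m.+1 j =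
  \sum_(i < n) \sum_(l < n | (l.+1 == j) && (l <= i)%N)
    H i l * \sum_(g : {ffun 'I_m -> 'I_n} * {ffun 'I_m -> 'I_n} |
       [forall s : 'I_m, (s == 0 :> nat) ==> (i < g.2 s)%N] && chain g)
       \prod_(r < m) H (g.1 r) (g.2 r).
Proof.
rewrite /Q (reindex (fun x : ('I_n * 'I_n) * ({ffun 'I_m -> 'I_n} * {ffun 'I_m -> 'I_n}) =>
  (cons x.1.1 x.2.1, cons x.1.2 x.2.2))) /=; last first.
  exists (fun p : {ffun 'I_m.+1 -> 'I_n} * {ffun 'I_m.+1 -> 'I_n} =>
      ((p.1 ord0, p.2 ord0), ([ffun r : 'I_m => p.1 (lift ord0 r)],
                              [ffun r : 'I_m => p.2 (lift ord0 r)]))) => /=.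
    case=> [[i l] [g1 g2]] _ /=; rewrite !cons0; congr (_, (_, _)).
      by apply/ffunP => r; rewrite ffunE consS.
    by apply/ffunP => r; rewrite ffunE consS.
  case=> [f1 f2] _ /=; congr (_, _); apply/ffunP => r.
    by case: (unliftP ord0 r) => [r'|] ->; rewrite ?consS ?cons0 ?ffunE.
  by case: (unliftP ord0 r) => [r'|] ->; rewrite ?consS ?cons0 ?ffunE.
under [RHS]eq_bigr do under eq_bigr do rewrite mulr_sumr.
rewrite pair_big_dep /= pair_big_dep /=.
apply: eq_big => [[[i l] [g1 g2]]|[[i l] [g1 g2]] _] /=.
  by rewrite QindexE /= cons0 chain_cons andbA.
rewrite big_ord_recl /= !cons0; congr (_ * _); apply: eq_bigr => r _.
by rewrite !consS.
Qed.

Lemma Q1 j : Q H 1 j.+1 = cumulated H n j.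
Proof.
rewrite Q_cons /cumulated; apply: eq_big => [i|i _]; first by rewrite ltn_ord.
apply: eq_bigr => l _; rewrite (big_pred1 (([ffun r => i], [ffun r => i]) :
    {ffun 'I_0 -> 'I_n} * {ffun 'I_0 -> 'I_n})) ?big_ord0 ?mulr1 // => -[g1 g2] /=.
rewrite /chain (_ : (g1, g2) == _ = true); last first.
  by apply/eqP; congr (_, _); apply/ffunP => -[].
by apply/and3P; split; apply/forallP => -[].
Qed.

(** Split off the first pair [(i, l)] and group the remaining chains by their first column [k]: the
    entries [H i l] with [i < k] add up to a cumulated step. *)
Lemma Q_rec m j : Q H m.+2 j.+1 =
  \sum_(k < n) Q H m.+1 k.+1 * cumulated H k j.
Proof.
rewrite Q_cons.
have tail i : \sum_(g : {ffun 'I_m.+1 -> 'I_n} * {ffun 'I_m.+1 -> 'I_n} |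
     [forall s : 'I_m.+1, (s == 0 :> nat) ==> (i < g.2 s)%N] && chain g)
       \prod_(r < m.+1) H (g.1 r) (g.2 r) = \sum_(k < n | (i < k)%N) Q H m.+1 k.+1.
  rewrite (partition_big (fun g : {ffun 'I_m.+1 -> 'I_n} * {ffun 'I_m.+1 -> 'I_n} =>
    g.2 ord0) (fun k : 'I_n => (i < k)%N)) /=; last first.
    by move=> g /andP[/forallP/(_ ord0)].
  apply: eq_bigr => k ik; apply: eq_bigl => g; rewrite QindexE eqSS val_eqE.
  case: eqP => [gk|]; rewrite ?andbF // andbT.
  case: (chain g); rewrite ?andbF // andbT; apply/forallP => s; apply/implyP => /eqP s0.
  by rewrite (_ : s = ord0) ?gk //; apply/val_inj.
under eq_bigr do under eq_bigr do rewrite tail mulr_sumr.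
under [RHS]eq_bigr do rewrite mulr_sumr.
rewrite [RHS](exchange_big_dep xpredT) //=; apply: eq_bigr => i _.
under [RHS]eq_bigr do rewrite mulr_sumr.
rewrite (exchange_big_dep (fun k : 'I_n => (i < k)%N)) //=.
by apply: eq_bigr => k ik; apply: eq_big => l; rewrite ?ik ?andbT // mulrC.
Qed.

(** This is the extra term when the sum over ['I_n] in [Q_rec] is read as a product of matrices of
    size [n.+1]. *)
Lemma Q_out m : Q H m.+1 n.+1 = 0.
Proof.
rewrite Q_cons big1 // => i _; rewrite big1 // => l /andP[/eqP [ln] _].
by have := ltn_ord l; rewrite ln ltnn.
Qed.

Local Notation Mx := (coef_mx (cumulated H) n.+1).

Lemma Q_power m (j : 'I_n.+1) : Q H m.+1 j.+1 = (Mx ^+ m.+1) ord_max j.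
Proof.
elim: m j => [|m IH] j; first by rewrite Q1 expr1 mxE.
rewrite Q_rec exprSr -mulmxE mxE big_ord_recr /= -IH Q_out mul0r addr0.
by apply: eq_bigr => k _; rewrite (IH (widen_ord (leqnSn n) k)) !mxE.
Qed.

End PathSums.

(** * Series solution and uniqueness for the Lyapunov equation *)

Section LyapunovSum.
Variables (R : realType) (n : nat).

Let c (l m : nat) : R := (-1) ^+ (l + m) * 'C(l + m, m)%:R.

Let shift_sum (V : lmodType R) (a : nat -> R) (g : nat -> V) : g n.+1 = 0 ->
  \sum_(l < n.+1) a l *: g l.+1
    = \sum_(l < n.+1) (if (l : nat) is l'.+1 then a l' else 0) *: g l.
Proof.
move=> g0; transitivity (\sum_(l < n.+2) (if (l : nat) is l'.+1 then a l' else 0) *: g l).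
  by rewrite [RHS]big_ord_recl scale0r add0r.
by rewrite big_ord_recr /= g0 scaler0 addr0.
Qed.

(* The generating function of the coefficients is 1 / (1 + x + y). *)
Let lyapunov_coef_sum (V : lmodType R) (f : nat -> nat -> V) :
  (forall m, f n.+1 m = 0) -> (forall l, f l n.+1 = 0) ->
  \sum_(l < n.+1) \sum_(m < n.+1) c l m *: (f l m + f l m.+1 + f l.+1 m) = f 0%N 0%N.
Proof.
move=> f0l f0r.
pose c1 l m := if m is m'.+1 then c l m' else 0.
pose c2 l m := if l is l'.+1 then c l' m else 0.
have Pascal l m : c l m + c1 l m + c2 l m = ((l == 0) && (m == 0))%:R.
  rewrite /c1 /c2 /c; case: l m => [|l] [|m].
  - by rewrite bin0 expr0 mulr1 !addr0.
  - by rewrite !add0n !binn exprS addr0 !mulr1 mulN1r addNr.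
  - by rewrite !addn0 !bin0 exprS addr0 !mulr1 mulN1r addNr.
  rewrite !addSn !addnS binS natrD !exprS /=; ring.
under eq_bigr do under eq_bigr do rewrite !scalerDr.
under eq_bigr do rewrite !big_split /=.
rewrite !big_split /=.
have -> : \sum_(l < n.+1) \sum_(m < n.+1) c l m *: f l m.+1 =
    \sum_(l < n.+1) \sum_(m < n.+1) c1 l m *: f l m.
  by apply: eq_bigr => l _; exact: (@shift_sum V (c l) (f l)).
have -> : \sum_(l < n.+1) \sum_(m < n.+1) c l m *: f l.+1 m =
    \sum_(l < n.+1) \sum_(m < n.+1) c2 l m *: f l m.
  rewrite exchange_big [RHS]exchange_big; apply: eq_bigr => m _.
  exact: (@shift_sum V (c^~ m) (f^~ m)).
rewrite -!big_split /=; under eq_bigr do rewrite -!big_split /=.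
under eq_bigr do under eq_bigr do rewrite -!scalerDl Pascal.
rewrite big_ord_recl big_ord_recl /= scale1r !big1 ?addr0 // => l _.
  by rewrite big1 // => m _; rewrite scale0r.
by rewrite scale0r.
Qed.

Variable M : nat -> nat -> R.
Hypothesis M_lower : forall k j, (k <= j)%N -> M k j = 0.
Local Notation Mx := (coef_mx M n.+1).
Let u m : 'rV_n.+1 := row ord_max (Mx ^+ m).

Lemma coef_mx_power_lower m (k j : 'I_n.+1) : (k < j + m)%N -> (Mx ^+ m) k j = 0.
Proof.
elim: m k => [|m IH] k kj.
  by rewrite expr0 mxE -val_eqE /= ltn_eqF // -[X in (_ < X)%N]addn0.
rewrite exprS -mulmxE mxE big1 // => i _; rewrite mxE.
case: (leqP k i) => ki; first by rewrite M_lower ?mul0r.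
by rewrite IH ?mulr0 // -ltnS -addnS (leq_trans _ kj).
Qed.

(* Up to the factor -N, the off-diagonal entries are the H-certificates: the terms with
   l = 0 or m = 0 only contribute in the last row or column. *)
Definition lyapunov_sum : 'M[R]_n.+1 :=
  \sum_(l < n.+1) \sum_(m < n.+1) c l m *: ((u l)^T *m u m).

(** Multiplication by [Mx] shifts [u m] to [u m.+1], and [u n.+1 = 0] by nilpotency, so
    [lyapunov_coef_sum] leaves only the term [l = m = 0]. *)
Lemma lyapunov_sum_eq :
  lyapunov_sum + lyapunov_sum *m Mx + Mx^T *m lyapunov_sum
    = delta_mx ord_max ord_max.
Proof.
have uS m : u m *m Mx = u m.+1 by rewrite -row_mul mulmxE -exprSr.
have uN : u n.+1 = 0.
  apply/rowP => j; rewrite !mxE coef_mx_power_lower //.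
  by rewrite addnS ltnS leq_addl.
have <- : (u 0%N)^T *m u 0%N = delta_mx ord_max ord_max.
  by rewrite /u expr0 rowE mulmx1 trmx_delta mul_delta_mx.
have <- := @lyapunov_coef_sum _ (fun l m => (u l)^T *m u m).
- rewrite /lyapunov_sum mulmx_suml mulmx_sumr -!big_split; apply: eq_bigr => l _ /=.
  rewrite mulmx_suml mulmx_sumr -!big_split; apply: eq_bigr => m _ /=.
  rewrite -scalemxAl -scalemxAr -mulmxA uS mulmxA -trmx_mul uS.
  by rewrite !scalerDr.
- by move=> m; rewrite uN trmx0 mul0mx.
- by move=> l; rewrite uN mulmx0.
Qed.

(** [M] is strictly lower triangular, so the equation at [(a, b)] expresses [D a b] through entries
    closer to the bottom right corner; induct on the distance to it. *)
Lemma lyapunov_unique (D : 'M[R]_n.+1) : D + D *m Mx + Mx^T *m D = 0 -> D = 0.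
Proof.
move=> /matrixP DE; apply/matrixP => a b; rewrite [RHS]mxE.
have [d] := ubnP (n - a + (n - b)).
elim: d a b => // d IH a b ab; have := DE a b; rewrite !mxE.
have an : (a <= n)%N by rewrite -ltnS.
have bn : (b <= n)%N by rewrite -ltnS.
rewrite big1 => [|i _].
  rewrite big1 ?addr0 // => i _; rewrite !mxE.
  case: (leqP i a) => ia; first by rewrite M_lower ?mul0r.
  have := ltn_ord i; rewrite ltnS => in_.
  by rewrite (IH i b) ?mulr0 //; lia.
rewrite !mxE; case: (leqP i b) => ib; first by rewrite M_lower ?mulr0.
have := ltn_ord i; rewrite ltnS => in_.
by rewrite (IH a i) ?mul0r //; lia.
Qed.

Lemma lyapunov_sumE (a b : 'I_n.+1) : lyapunov_sum a b =
  \sum_(l < n.+1) \sum_(m < n.+1)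
    (-1) ^+ (l + m) * 'C(l + m, m)%:R * (Mx ^+ l) ord_max a * (Mx ^+ m) ord_max b.
Proof.
rewrite summxE; apply: eq_bigr => l _; rewrite summxE; apply: eq_bigr => m _.
by rewrite !mxE big_ord1 !mxE /c !mulrA.
Qed.

End LyapunovSum.

(** * H-certificates as entries of the certificate matrix *)

Section Certificates.
Variables (R : realType) (n : nat) (H : 'M[R]_n).
Local Notation M := (cumulated H).
Local Notation Mx := (coef_mx M n.+1).

Lemma certificate_lyapunov (j k : 'I_n.+1) : (j < k)%N ->
  certificate n.+1 H k.+1 j.+1 = - n.+1%:R * lyapunov_sum n M j k.
Proof.
move=> jk; rewrite /certificate lyapunov_sumE.
have jn : (j < n)%N by rewrite (leq_trans jk) // -ltnS.
have power0 (a : 'I_n.+1) : (Mx ^+ 0) ord_max a = (a == n :> nat)%:R.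
  by rewrite expr0 mxE eq_sym -val_eqE.
(* The terms with [l = 0] vanish since [j < n]. If [k = n], positive powers have zero diagonal and
   only [m = 0] survives; otherwise the terms with [m = 0] vanish too. *)
rewrite eqSS mulNr -mulrN; case: eqP => kn; congr (_ * _).
  rewrite big_add1 big_mkord big_ord_recl /= [X in - (X + _)]big1 ?add0r; last first.
    by move=> m _; rewrite power0 ltn_eqF // mulr0 mul0r.
  rewrite -sumrN; apply: eq_bigr => l _; rewrite big_ord_recl /= big1 ?addr0; last first.
    move=> m _; rewrite [X in _ * X](coef_mx_power_lower (@cumulated_lower _ _ H)) ?mulr0 //.
    by rewrite kn /= addnS ltnS leq_addr.
  rewrite power0 kn eqxx mulr1 bin0 mulr1 addn0 Q_power.
  by rewrite subn1 /bump leq0n add1n [(-1) ^+ _.+1]exprS; ring.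
rewrite big_add1 big_mkord [in RHS]big_ord_recl /= [X in - (X + _)]big1 ?add0r; last first.
  by move=> m _; rewrite power0 ltn_eqF // mulr0 mul0r.
rewrite -sumrN; apply: eq_bigr => l _; rewrite big_add1 big_mkord.
rewrite [in RHS]big_ord_recl power0 (_ : (k == n :> nat) = false) ?mulr0 ?add0r; last exact/eqP.
rewrite -sumrN; apply: eq_bigr => m _; rewrite !Q_power /= /bump !leq0n !add1n.
by rewrite addSn subn1 /= [(-1) ^+ _.+1]exprS; ring.
Qed.

Hypothesis H_star : Hstar R n.+1 H.

(** The certificate matrix and [n.+1 ^ 2] times [lyapunov_sum] solve the same Lyapunov equation,
    hence coincide. *)
Lemma certificate_cert_mx (j k : 'I_n.+1) : (j < k)%N ->
  certificate n.+1 H k.+1 j.+1 = - n.+1%:R^-1 * cert_mx (iterate_mx M n.+1) k j.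
Proof.
move=> jk; rewrite certificate_lyapunov //.
set P := cert_mx _.
have PE : P = n.+1%:R ^+ 2 *: lyapunov_sum n M.
  apply/eqP; rewrite -subr_eq0; apply/eqP.
  apply: (@lyapunov_unique _ _ _ (@cumulated_lower R n H)).
  have := cert_mx_lyapunov (cumulated_triu1 _ _) (iterate_mx_one _ _)
    (iterate_mx_unit H_star (leqnn _)) (iterate_mx_tr_last H_star).
  have := lyapunov_sum_eq n (@cumulated_lower R n H); rewrite -/P.
  move: P (lyapunov_sum _ _) Mx => P L A <- PA.
  rewrite mulmxBl mulmxBr -scalemxAl -scalemxAr; move: PA.
  move: (P *m _) (L *m _) (_ *m P) (_ *m L) => B C D E PA.
  apply/matrixP => a b; move/matrixP: PA => /(_ a b); rewrite !mxE.
  by move: (n.+1%:R ^+ 2) => N; lra.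
have PT : P^T = P by exact: cert_mx_sym.
have -> : P k j = P j k by rewrite -[in LHS]PT mxE.
by rewrite PE mxE; field; rewrite nat1r pnatr_eq0.
Qed.

End Certificates.

(** * Decomposable matrices *)

Section Decomposition.
Variables (R : realType) (m p : nat).
(** Here [m.+1] is [N'] and [n.+1] is [N]; as [n.+1] is convertible to [m.+1 + p.+1], matrices split
    into blocks at [N'] without casts. *)
Local Notation n := (m + p.+1)%N.
Variable H : 'M[R]_n.
Local Notation M := (cumulated H).
Local Notation S' := (iterate_mx M m.+1).
Local Notation S := (iterate_mx M (m.+1 + p.+1)).
Local Notation P' := (cert_mx S').
Local Notation P := (@cert_mx R n S : 'M[R]_(m.+1 + p.+1)).

Hypothesis H_star : Hstar R n.+1 H.
Hypothesis H_decomposable : decomposable n.+1 H m.+1.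

Let S'_unit : S' \in unitmx.
Proof. by apply: iterate_mx_unit => //; rewrite ltnS leq_addr. Qed.

Let S_unit : S \in unitmx.
Proof. exact: iterate_mx_unit. Qed.

Let L21 : 'M[R]_(p.+1, m.+1) := dlsubmx (invmx S : 'M[R]_(m.+1 + p.+1)).
Let L22 : 'M[R]_p.+1 := drsubmx (invmx S : 'M[R]_(m.+1 + p.+1)).
Let S21 : 'M[R]_(p.+1, m.+1) := dlsubmx S.
Let S22 : 'M[R]_p.+1 := drsubmx S.

Let S_block : S = block_mx S' 0 S21 S22.
Proof.
rewrite -[LHS](@submxK R m.+1 p.+1 m.+1 p.+1); congr (block_mx _ _ _ _).
  by apply/matrixP => i j; rewrite !mxE.
apply/matrixP => i j; rewrite !mxE coef_iterate_poly_gt //=.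
by rewrite (leq_trans (ltn_ord i)) // leq_addr.
Qed.

Let L_block : invmx S = block_mx (invmx S') 0 L21 L22.
Proof.
set L : 'M[R]_(m.+1 + p.+1) := invmx S.
have SL : S *m L = 1%:M :> 'M[R]_(m.+1 + p.+1) by exact: mulmxV.
move: SL; rewrite S_block -[L](@submxK R m.+1 p.+1 m.+1 p.+1) -/L21 -/L22.
rewrite mulmx_block !mul0mx !addr0.
rewrite scalar_mx_block.
move=> /eq_block_mx[ul ur _ _]; congr (block_mx _ _ _ _).
  by apply: (can_inj (mulKmx S'_unit)); rewrite ul mulmxV.
by apply: (can_inj (mulKmx S'_unit)); rewrite ur mulmx0.
Qed.

Let P_block : P = block_mx (P' + L21^T *m L21) (L21^T *m L22)
                           (L22^T *m L21) (L22^T *m L22).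
Proof.
have -> : P = (invmx S : 'M[R]_(m.+1 + p.+1))^T *m (invmx S : 'M[R]_(m.+1 + p.+1)) by [].
rewrite L_block tr_block_mx mulmx_block trmx0.
by rewrite !mul0mx !mulmx0 !add0r.
Qed.

Let L22_unit : L22 \in unitmx.
Proof.
have : invmx S \in unitmx by rewrite unitmx_inv.
by rewrite L_block unitmxE det_lblock unitrM => /andP[].
Qed.

(** Condition (ii) of decomposability covers the rows before the last, condition (i) the last one;
    the excluded corner carries the positive certificate at [(N, N')]. *)
Let P_zero (a : 'I_m.+1) (b : 'I_p.+1) :
  (a != ord_max) || (b != ord_max) -> P (lshift p.+1 a) (rshift m.+1 b) = 0.
Proof.
move=> ab; have lt_ab : (lshift p.+1 a < rshift m.+1 b)%N.
  by rewrite /= (leq_trans (ltn_ord a)) // leq_addr.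
have : certificate n.+1 H (rshift m.+1 b).+1 (lshift p.+1 a).+1 = 0.
  case: H_decomposable => _ _ [_ c1] c2.
  have := ltn_ord a; have := ltn_ord b; rewrite !ltnS => bp.
  rewrite leq_eqVlt => /predU1P[am|am]; last by apply: c2; rewrite /=; lia.
  have bp' : (b < p)%N.
    rewrite ltn_neqAle bp andbT; apply: contraTneq ab => bp'.
    by rewrite negb_or !negbK; apply/andP; split; apply/eqP/val_inj.
  by rewrite /= am; apply: c1; lia.
rewrite (certificate_cert_mx H_star (j := lshift p.+1 a) (k := rshift m.+1 b)) //.
move/eqP; rewrite mulf_eq0 oppr_eq0 invr_eq0 pnatr_eq0 /= => /eqP.
have PT : P^T = P by exact: cert_mx_sym.
by rewrite -[in LHS]PT mxE.
Qed.

Let w : 'cV[R]_p.+1 := (invmx L22)^T *m (L22^T *m L21) *m delta_mx ord_max 0.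

(** By [P_zero], the block [L22^T L21] of [P] vanishes outside its last column, and [L22] is
    invertible. *)
Let L21_rank1 : L21 = w *m delta_mx 0 ord_max.
Proof.
have E : L22^T *m L21 = (L22^T *m L21) *m
      ((delta_mx ord_max 0 : 'cV[R]_m.+1) *m (delta_mx 0 ord_max : 'rV[R]_m.+1)).
  rewrite mul_delta_mx; apply/matrixP => b a; rewrite [RHS]mxE.
  have PE : (L22^T *m L21) b a = P (lshift p.+1 a) (rshift m.+1 b).
    have PT : P^T = P by exact: cert_mx_sym.
    by rewrite -PT [RHS]mxE P_block block_mxEdl.
  have [->|am] := eqVneq a ord_max.
    rewrite (bigD1 ord_max) //= big1 ?addr0 => [|i /negPf im]; last first.
      by rewrite [delta_mx _ _ _ _]mxE im mulr0.
    by rewrite [delta_mx _ _ _ _]mxE !eqxx mulr1.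
  rewrite PE P_zero ?am // big1 // => i _.
  by rewrite [delta_mx _ _ _ _]mxE (negPf am) andbF mulr0.
have -> : L21 = (invmx L22)^T *m (L22^T *m L21).
  by rewrite mulmxA -trmx_mul mulmxV // trmx1 mul1mx.
by rewrite {1}E /w !mulmxA.
Qed.

Lemma decomposable_last (i : 'I_m.+1) : S' ord_max i = m.+1%:R^-1.
Proof.
(* The lower left block of [S S^-1 = 1] reads [S21 S'^-1 + S22 L21 = 0]. *)
have S21E : S21 = - (S22 *m w) *m row ord_max S'.
  have : S *m invmx S = 1%:M :> 'M[R]_(m.+1 + p.+1) by exact: mulmxV.
  rewrite L_block S_block mulmx_block scalar_mx_block.
  move=> /eq_block_mx[_ _ /eqP + _]; rewrite addr_eq0 => /eqP S21E.
  rewrite -[LHS](mulmxKV S'_unit) S21E L21_rank1 !mulNmx.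
  by rewrite rowE !mulmxA.
pose g := - (S22 *m w) ord_max 0.
have gE j : g * S' ord_max j = n.+1%:R^-1.
  have <- : S21 ord_max j = n.+1%:R^-1.
    rewrite -(iterate_mx_last H_star (lshift p.+1 j)) !mxE /=.
    by rewrite addSnnS.
  by rewrite S21E [RHS]mxE big_ord1 /g !mxE.
(* Sum [gE] over a row of [S'], whose entries add up to 1. *)
have g1 : g = m.+1%:R / n.+1%:R.
  have <- : \sum_(j < m.+1) g * S' ord_max j = m.+1%:R / n.+1%:R.
    under eq_bigr do rewrite gE; rewrite sumr_const card_ord mulr_natl.
    by [].
  rewrite -mulr_sumr -[LHS]mulr1 -(iterate_mx_rowsum M (ltnSn m)); congr (_ * _).
  by apply: eq_bigr => j _; rewrite mxE.
have := gE i; rewrite g1 => /(canRL (mulKf _)) ->.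
  by rewrite invf_div mulrAC divff ?mul1r ?pnatr_eq0.
by rewrite mulf_neq0 ?invr_eq0 ?pnatr_eq0.
Qed.

(** The correction [L21^T L21] lives in the last diagonal entry, so the sign is inherited from
    [P]. *)
Lemma decomposable_offdiag (k j : 'I_m.+1) : (j < k)%N -> P' k j <= 0.
Proof.
move=> jk; have <- : P (lshift p.+1 k) (lshift p.+1 j) = P' k j.
  rewrite P_block block_mxEul mxE [(L21^T *m L21) k j]mxE big1 ?addr0 // => b _.
  have j_last : (j == ord_max) = false.
    by apply/negbTE; rewrite -val_eqE neq_ltn /= (leq_trans jk) // -ltnS.
  by rewrite {2}L21_rank1 [(w *m _) b j]mxE big_ord1 [delta_mx _ _ _ _]mxE j_last !mulr0.
exact: (cert_mx_offdiag H_star (j := lshift p.+1 j) (k := lshift p.+1 k)).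
Qed.

End Decomposition.

Theorem corollary2 (R : realType) (N : nat) (hN : (1 <= N)%N)
    (H : 'M[R]_(N.-1)) (N' : nat) (hN' : (1 <= N' < N)%N) :
  vertex N H -> decomposable N H N' ->
  forall (X : hilbertType R) (T : X -> X) (ystar : X) (y : nat -> X),
    nonexpansive T -> T ystar = ystar -> iterates N H T y ->
    `|y N'.-1 - T (y N'.-1)| ^+ 2 <= 4 * `|y 0%N - ystar| ^+ 2 / N'%:R ^+ 2.
Proof.
move=> _ H_dec X T ystar y Tne Tfix.
case: N' hN' H_dec => // m /= mN.
have [p Np] : exists p, N = (m + p.+1).+1.
  by exists (N - m.+2)%N; lia.
subst N => H_dec /iterates_cumulated yE.
have [H_star _ _ _] := H_dec.
have S_unit : iterate_mx (cumulated H) m.+1 \in unitmx.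
  by apply: iterate_mx_unit => //; rewrite ltnS leq_addr.
have S_last : (iterate_mx (cumulated H) m.+1)^T *m (delta_mx ord_max 0 : 'cV_m.+1)
    = m.+1%:R^-1 *: const_mx 1.
  rewrite -colE; apply/colP => i; rewrite [RHS]mxE [const_mx _ _ _]mxE mulr1.
  by rewrite -(decomposable_last H_star H_dec i) !mxE.
have P_one := cert_mx_one (iterate_mx_one H m.+1) S_unit S_last.
apply: (@certificate_sufficient R X m (coef_mx (cumulated H) m.+1)
  (cert_mx (iterate_mx (cumulated H) m.+1))) => //.
- exact: cert_mx_sym.
- move=> k; have /colP/(_ k) := P_one; rewrite mxE => PE.
  transitivity (\sum_j cert_mx (iterate_mx (cumulated H) m.+1) k j
      * (const_mx 1 : 'cV[R]_m.+1) j 0).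
    by apply: eq_bigr => j _; rewrite [const_mx _ _ _]mxE mulr1.
  by rewrite PE !mxE eqxx andbT.
- exact: cert_mx_lyapunov (cumulated_triu1 H m.+1) (iterate_mx_one H m.+1) S_unit S_last.
- exact: decomposable_offdiag H_star H_dec.
(* Row [k] of the cumulated steps stops before column [k], so the sum over all columns of [H] and
   the sum over the truncated range agree. *)
move=> k; have kn : (k <= m + p.+1)%N.
  by apply: leq_trans (leq_addr _ _); rewrite -ltnS.
rewrite [LHS]yE //; congr (_ - _).
transitivity (\sum_(j < k) cumulated H k j *: (y j - T (y j))).
  apply: (sum_lower (cumulated_lower H) (fun j => y j - T (y j))).
  by rewrite leqW.
rewrite -(sum_lower (cumulated_lower H) (fun j => y j - T (y j)) (ltnW (ltn_ord k))).
by apply: eq_bigr => j _; rewrite mxE.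
Qed.
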